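(* Let $f\in\mathbb{C}[x_1,\dots,x_n]$ be a weighted homogeneous polynomial such that $V(f)$ has an isolated singularity at the origin. Let $m_i$ be the multiplicity of $f_i=\partial f/\partial x_i$ and $m_{i,j}=\min\{m_i,m_j\}$. Let $L_1<\dots<L_k$ be the gap numbers of $Z^{(2)}$, and let $\mathbb{Z}_\infty(t)$ and $\mathbb{H}_{L_i}(t)$ be the Hilbert-Poincaré series of the graded modules $Z^{(2)}_\infty$ and $Z^{(2)}_{L_i}/Z^{(2)}_{L_i+1}$ (all defined in the context). Then the series $\mathbb{M}_f(t)=\sum_{k\ge0}\mu_kt^k$ and $\mathbb{A}_f(t)=\sum_{k\ge0}\tau_kt^k$ of the $k$-th Milnor numbers and $k$-th Tjurina numbers of $f$ are given by $$\mathbb{M}_f(t)=\frac{t}{(1-t)^{n+1}}\Big(n-\sum_{i<j}t^{m_{i,j}}\Big)+\frac{\mu_0+\mathbb{Z}_\infty(t)\cdot t}{1-t}+\sum_{i=1}^{k}\frac{t-t^{L_i+1}}{1-t}\,\mathbb{H}_{L_i}(t)$$ and $$\mathbb{A}_f(t)=\frac{t}{(1-t)^{n+1}}\Big(n-t-\sum_{i<j}t^{m_{i,j}}\Big)+\frac{\mu_0+\mathbb{Z}_\infty(t)\cdot t}{1-t}+\sum_{i=1}^{k}\frac{t-t^{L_i+1}}{1-t}\,\mathbb{H}_{L_i}(t).$$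
   Context: $\mathcal{O}=\mathbb{C}[[x_1,\dots,x_n]]$ with maximal ideal $m$ ($m^0=\mathcal{O}$), $J(f)=(f_1,\dots,f_n)\subseteq\mathcal{O}$, $\mu_k=\dim_{\mathbb{C}}\mathcal{O}/m^kJ(f)$, $\tau_k=\dim_{\mathbb{C}}\mathcal{O}/(f,m^kJ(f))$. A polynomial is weighted homogeneous if for some positive rational weights $w_1,\dots,w_n$ and some constant $W$ each of its monomials $x_1^{i_1}\cdots x_n^{i_n}$ satisfies $\sum_j i_jw_j=W$. The multiplicity of a nonzero polynomial is the lowest total degree of its monomials. Let $\mathcal{P}=\mathbb{C}[x_1,\dots,x_n]$ with $\deg x_i=1$. Let $E^{(1)}$ be the free graded $\mathcal{P}$-module on $v_1,\dots,v_n$ with $\deg v_i=0$, and $E^{(2)}$ the free graded $\mathcal{P}$-module on $v_{i,j}$ ($1\le i<j\le n$) with $\deg v_{i,j}=m_{i,j}$. Let $\mu$ be an additional variable of degree $-1$ and $E^{(r)}[\mu]=E^{(r)}\otimes_{\mathcal{P}}\mathcal{P}[\mu]$. Define the degree-preserving $\mathcal{P}[\mu]$-linear map $\Delta_2:E^{(2)}[\mu]\to E^{(1)}[\mu]$ by $$\Delta_2(v_{i,j})=\mathcal{T}^{\mu}_{i,j}:=\frac{1}{\mu^{m_{i,j}}}\big(f_i(\mu\mathbf{x})v_j-f_j(\mu\mathbf{x})v_i\big),\qquad f_i(\mu\mathbf{x})=f_i(\mu x_1,\dots,\mu x_n).$$ For $l\ge1$ let $\tilde Z^{(2)}_l$ be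 the kernel of the induced map $E^{(2)}[\mu]/\langle\mu^l\rangle\to E^{(1)}[\mu]/\langle\mu^l\rangle$, and let $Z^{(2)}_l\subseteq E^{(2)}$ be the image of $\tilde Z^{(2)}_l$ under reduction modulo $\mu$ ($E^{(2)}[\mu]/\langle\mu^l\rangle\to E^{(2)}[\mu]/\langle\mu\rangle=E^{(2)}$). These form a decreasing chain of graded submodules; put $Z^{(2)}=Z^{(2)}_1$ and $Z^{(2)}_\infty=\bigcap_{l\ge1}Z^{(2)}_l$. An integer $l\ge1$ is a gap number of $Z^{(2)}$ if $Z^{(2)}_l\ne Z^{(2)}_{l+1}$; there are finitely many gap numbers. The Hilbert-Poincaré series of a graded module $E=\bigoplus_iE_i$ is $\sum_{i\ge0}\dim_{\mathbb{C}}(E_i)t^i$. *)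

(* Defs.v *)
From HB Require Import structures.
From mathcomp Require Import all_boot all_order all_algebra.
From mathcomp Require Import boolp.
From mathcomp.multinomials Require Import mpoly.

Set Implicit Arguments.
Unset Strict Implicit.
Unset Printing Implicit Defensive.

Import GRing.Theory Num.Theory.

Local Open Scope ring_scope.

(* Formal power series R[[x_1, ..., x_n]], given by their coefficients.       *)

Record mpseries (R : Type) (n : nat) :=
  MPSeries { pscoef :> 'X_{1..n} -> R }.

Notation "{ 'mpseries' R [ n ] }" := (mpseries R n)
  (at level 0, R, n at level 2, format "{ 'mpseries'  R [ n ] }") : type_scope.

HB.instance Definition _ (R : Type) (n : nat) :=
  gen_eqMixin {mpseries R[n]}.
HB.instance Definition _ (R : Type) (n : nat) :=
  gen_choiceMixin {mpseries R[n]}.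

Lemma mpseriesP (R : Type) (n : nat) (p q : {mpseries R[n]}) :
  p =1 q -> p = q.
Proof. by case: p q => [p] [q] /funext /= ->. Qed.

Section Zmodule.
Context (R : zmodType) (n : nat).
Implicit Types p q r : {mpseries R[n]}.

Definition ps_zero : {mpseries R[n]} := MPSeries (fun=> 0).
Definition ps_opp p : {mpseries R[n]} := MPSeries (fun m => - p m).
Definition ps_add p q : {mpseries R[n]} := MPSeries (fun m => p m + q m).

Fact ps_addA : associative ps_add.
Proof. by move=> p q r; apply: mpseriesP => m /=; rewrite addrA. Qed.
Fact ps_addC : commutative ps_add.
Proof. by move=> p q; apply: mpseriesP => m /=; rewrite addrC. Qed.
Fact ps_add0 : left_id ps_zero ps_add.
Proof. by move=> p; apply: mpseriesP => m /=; rewrite add0r. Qed.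
Fact ps_addN : left_inverse ps_zero ps_opp ps_add.
Proof. by move=> p; apply: mpseriesP => m /=; rewrite addNr. Qed.

HB.instance Definition _ :=
  GRing.isZmodule.Build {mpseries R[n]} ps_addA ps_addC ps_add0 ps_addN.

Lemma ps_coef0 m : (0 : {mpseries R[n]}) m = 0. Proof. by []. Qed.
Lemma ps_coefD p q m : (p + q) m = p m + q m. Proof. by []. Qed.
Lemma ps_coefN p m : (- p) m = - p m. Proof. by []. Qed.
Lemma ps_coefB p q m : (p - q) m = p m - q m. Proof. by []. Qed.

Lemma ps_coef_sum (I : Type) (s : seq I) (P : pred I)
    (F : I -> {mpseries R[n]}) m :
  (\sum_(i <- s | P i) F i) m = \sum_(i <- s | P i) F i m.
Proof. exact: (big_morph (fun p : {mpseries R[n]} => p m)). Qed.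

End Zmodule.

Section Ring.
Context (R : comNzRingType) (n : nat).
Implicit Types p q r : {mpseries R[n]}.

Definition ps_one : {mpseries R[n]} := MPSeries (fun m => (m == 0%MM)%:R).

Definition ps_mul p q : {mpseries R[n]} := MPSeries (fun m =>
  \sum_(k : 'X_{1..n < (mdeg m).+1, (mdeg m).+1} | m == (k.1 + k.2)%MM)
     p k.1 * q k.2).

Definition ps_scale (c : R) p : {mpseries R[n]} := MPSeries (fun m => c * p m).

Definition mpseries_of (p : {mpoly R[n]}) : {mpseries R[n]} :=
  MPSeries (fun m => p@_m).

Definition ps_trunc (N : nat) p : {mpoly R[n]} :=
  \sum_(m : 'X_{1..n < N}) p m *: 'X_[m].

Lemma ps_truncE N p m : (mdeg m < N)%N -> (ps_trunc N p)@_m = p m.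
Proof. exact: mcoeff_mpoly. Qed.

Lemma mcoeffM_agree (a b c d : {mpoly R[n]}) m :
    (forall k, (mdeg k <= mdeg m)%N -> a@_k = b@_k) ->
    (forall k, (mdeg k <= mdeg m)%N -> c@_k = d@_k) ->
  (a * c)@_m = (b * d)@_m.
Proof.
move=> ab cd; rewrite !mcoeffM; apply: eq_bigr => k _.
by rewrite ab ?cd // -ltnS bmdeg.
Qed.

Lemma ps_mul_truncE N p q m :
  (mdeg m < N)%N -> ps_mul p q m = (ps_trunc N p * ps_trunc N q)@_m.
Proof.
move=> mN; rewrite mcoeffM /=; apply: eq_bigr => k _.
by rewrite !ps_truncE //; apply: leq_trans (bmdeg _) _.
Qed.

Fact ps_mulA : associative ps_mul.
Proof.
move=> p q r; apply: mpseriesP => m; have mN := ltnSn (mdeg m).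
rewrite !(ps_mul_truncE _ _ mN).
transitivity ((ps_trunc (mdeg m).+1 p *
   (ps_trunc (mdeg m).+1 q * ps_trunc (mdeg m).+1 r))@_m).
  apply: mcoeffM_agree => // k km.
  by rewrite ps_truncE ?ltnS // (@ps_mul_truncE (mdeg m).+1).
rewrite mulrA; apply: mcoeffM_agree => // k km.
by rewrite [RHS]ps_truncE ?ltnS // (@ps_mul_truncE (mdeg m).+1).
Qed.

Fact ps_mulC : commutative ps_mul.
Proof.
move=> p q; apply: mpseriesP => m.
by rewrite !(ps_mul_truncE _ _ (ltnSn _)) mulrC.
Qed.

Fact ps_mul1 : left_id ps_one ps_mul.
Proof.
move=> p; apply: mpseriesP => m; have mN := ltnSn (mdeg m).
rewrite (ps_mul_truncE _ _ mN) -[RHS](ps_truncE p mN) -[in RHS](mul1r (ps_trunc _ p)).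
by apply: mcoeffM_agree => // k km; rewrite ps_truncE ?ltnS // mcoeff1.
Qed.

Fact ps_mulDl : left_distributive ps_mul +%R.
Proof.
move=> p q r; apply: mpseriesP => m; rewrite ps_coefD -big_split /=.
by apply: eq_bigr => k _; rewrite mulrDl.
Qed.

Fact ps_one_neq0 : ps_one != 0.
Proof.
apply/eqP => /(congr1 (fun p : {mpseries R[n]} => p 0%MM)) /=.
by rewrite eqxx => /eqP; rewrite oner_eq0.
Qed.

HB.instance Definition _ := GRing.Zmodule_isComNzRing.Build {mpseries R[n]}
  ps_mulA ps_mulC ps_mul1 ps_mulDl ps_one_neq0.

Fact ps_scaleA a b p : ps_scale a (ps_scale b p) = ps_scale (a * b) p.
Proof. by apply: mpseriesP => m /=; rewrite mulrA. Qed.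
Fact ps_scale1 : left_id 1 ps_scale.
Proof. by move=> p; apply: mpseriesP => m /=; rewrite mul1r. Qed.
Fact ps_scaleDr : right_distributive ps_scale +%R.
Proof. by move=> a p q; apply: mpseriesP => m /=; rewrite mulrDr. Qed.
Fact ps_scaleDl p : {morph ps_scale^~ p : a b / a + b}.
Proof. by move=> a b; apply: mpseriesP => m /=; rewrite mulrDl. Qed.

HB.instance Definition _ := GRing.Zmodule_isLmodule.Build R {mpseries R[n]}
  ps_scaleA ps_scale1 ps_scaleDr ps_scaleDl.

Fact ps_scaleAl (a : R) (p q : {mpseries R[n]}) : a *: (p * q) = a *: p * q.
Proof.
apply: mpseriesP => m /=; rewrite big_distrr /=.
by apply: eq_bigr => k _; rewrite mulrA.
Qed.

HB.instance Definition _ :=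
  GRing.Lmodule_isLalgebra.Build R {mpseries R[n]} ps_scaleAl.

Lemma ps_coef1 m : (1 : {mpseries R[n]}) m = (m == 0%MM)%:R. Proof. by []. Qed.
Lemma ps_coefZ a p m : (a *: p) m = a * p m. Proof. by []. Qed.

Lemma ps_coefM p q m :
  (p * q) m =
    \sum_(k : 'X_{1..n < (mdeg m).+1, (mdeg m).+1} | m == (k.1 + k.2)%MM)
       p k.1 * q k.2.
Proof. by []. Qed.

Lemma ps_coefM_trunc N p q m :
  (mdeg m < N)%N -> (p * q) m = (ps_trunc N p * ps_trunc N q)@_m.
Proof. exact: ps_mul_truncE. Qed.

Lemma ps_coefM_agree p q r (s : {mpseries R[n]}) m :
    (forall k, (mdeg k <= mdeg m)%N -> p k = q k) ->
    (forall k, (mdeg k <= mdeg m)%N -> r k = s k) ->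
  (p * r) m = (q * s) m.
Proof.
move=> pq rs; rewrite !(ps_coefM_trunc _ _ (ltnSn _)).
by apply: mcoeffM_agree => k km; rewrite !ps_truncE ?ltnS ?pq ?rs.
Qed.

Lemma ps_coefM0 p q : (p * q) 0%MM = p 0%MM * q 0%MM.
Proof.
have N0 : (mdeg (0%MM : 'X_{1..n}) < 1)%N by rewrite mdeg0.
by rewrite (ps_coefM_trunc _ _ N0) rmorphM /= !ps_truncE.
Qed.

Lemma mpseries_of_is_zmod : zmod_morphism mpseries_of.
Proof. by move=> p q; apply: mpseriesP => m; rewrite /= mcoeffB. Qed.
HB.instance Definition _ := GRing.isZmodMorphism.Build
  {mpoly R[n]} {mpseries R[n]} mpseries_of mpseries_of_is_zmod.

Lemma mpseries_of_is_monoid : monoid_morphism mpseries_of.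
Proof.
split=> [|p q]; apply: mpseriesP => m; first by rewrite /= mcoeff1.
by rewrite /= mcoeffM.
Qed.
HB.instance Definition _ := GRing.isMonoidMorphism.Build
  {mpoly R[n]} {mpseries R[n]} mpseries_of mpseries_of_is_monoid.

Lemma ps_coef_exp_eq0 p k m :
  p 0%MM = 0 -> (mdeg m < k)%N -> (p ^+ k) m = 0.
Proof.
move=> p0; elim: k m => [//|k IH] m mk.
rewrite exprS ps_coefM big1 // => -[i j] /= /eqP mij.
have [i0|i0] := posnP (mdeg i).
  by move/eqP: i0; rewrite mdeg_eq0 => /eqP ->; rewrite p0 mul0r.
have mD : mdeg m = (mdeg i + mdeg j)%N by rewrite -mdegD -mij.
rewrite IH ?mulr0 //; rewrite -ltnS; apply: leq_ltn_trans mk.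
by rewrite [leqRHS]mD -add1n leq_add2r.
Qed.

End Ring.

(* Over a commutative ring with units, a series is invertible iff its         *)
(* constant term c is, with inverse c^-1 \sum_k (1 - c^-1 p)^k.               *)
Section UnitRing.
Context (R : comUnitRingType) (n : nat).
Implicit Types p q : {mpseries R[n]}.

Definition ps_unit : {pred {mpseries R[n]}} :=
  fun p => p 0%MM \is a GRing.unit.

Definition ps_inv p : {mpseries R[n]} :=
  if ps_unit p then MPSeries (fun m =>
    (p 0%MM)^-1 * \sum_(k < (mdeg m).+1) ((1 - (p 0%MM)^-1 *: p) ^+ k) m)
  else p.

Fact ps_mulV : {in ps_unit, left_inverse 1 ps_inv *%R}.
Proof.
move=> p pU; have cU : p 0%MM \is a GRing.unit by [].
apply: mpseriesP => m; rewrite /ps_inv ifT //.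
set c := p 0%MM; set q := 1 - c^-1 *: p.
have q0 : q 0%MM = 0.
  by rewrite /q ps_coefB ps_coef1 ps_coefZ eqxx mulVr ?subrr.
have -> : p = c *: (1 - q).
  by rewrite /q opprB addrC subrK scalerA mulrV // scale1r.
pose s := c^-1 *: \sum_(k < (mdeg m).+1) q ^+ k.
rewrite (@ps_coefM_agree _ _ _ s _ (c *: (1 - q))) //; last first.
  move=> k km; rewrite /s ps_coefZ ps_coef_sum /=; congr (_ * _).
  rewrite -(subnKC (_ : (mdeg k).+1 <= (mdeg m).+1)%N) ?ltnS //.
  rewrite big_split_ord /= [X in _ = _ + X]big1 ?addr0 // => i _.
  by rewrite ps_coef_exp_eq0 // leq_addr.
rewrite /s -scalerAl mulrC -!scalerAl scalerA mulVr // scale1r.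
rewrite -[1 - q]opprB mulNr -subrX1 opprB ps_coefB.
by rewrite (ps_coef_exp_eq0 q0) ?subr0.
Qed.

Fact ps_unitP p q : q * p = 1 -> ps_unit p.
Proof.
move=> /(congr1 (fun r : {mpseries R[n]} => r 0%MM)).
by rewrite ps_coefM0 ps_coef1 eqxx => qp; apply/unitrPr; exists (q 0%MM); rewrite mulrC.
Qed.

Fact ps_inv_out : {in [predC ps_unit], ps_inv =1 id}.
Proof. by move=> p pU; rewrite /ps_inv ifN. Qed.

HB.instance Definition _ := GRing.ComNzRing_hasMulInverse.Build
  {mpseries R[n]} ps_mulV ps_unitP ps_inv_out.

End UnitRing.

(* The generating series \sum_k (a k) t^k, in Q[[t]].                         *)

Definition tvar : {mpseries rat[1]} := mpseries_of 'X_ord0.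

Definition genseries (a : nat -> nat) : {mpseries rat[1]} :=
  MPSeries (fun m => (a (m ord0))%:R).

(* Ideals of a commutative ring, as predicates.                               *)

Section Ideals.
Context (A : comNzRingType).
Implicit Types (I J S : A -> Prop).

Definition ideal_gen S : A -> Prop := fun x =>
  exists s : seq (A * A),
    (forall q, q \in s -> S q.2) /\ x = \sum_(q <- s) q.1 * q.2.

Definition ideal_mul I J : A -> Prop :=
  ideal_gen (fun x => exists a b, [/\ I a, J b & x = a * b]).

Definition ideal_add I J : A -> Prop := fun x =>
  exists a b, [/\ I a, J b & x = a + b].

Fixpoint ideal_exp I (k : nat) : A -> Prop :=
  if k is k'.+1 then ideal_mul I (ideal_exp I k') else fun=> True.

End Ideals.

(* For subspaces B of A, is_dimq A B d states that dim_K (A / B) = d; dimq A B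
   is this dimension when it is finite and 0 otherwise.                       *)
Section Dimension.
Context (K : fieldType) (V : lmodType K).
Implicit Types (A B : V -> Prop).

Definition is_dimq A B (d : nat) : Prop :=
  exists b : 'I_d -> V,
    [/\ forall i, A (b i),
        forall v, A v -> exists c : 'I_d -> K, B (v - \sum_i c i *: b i)
      & forall c : 'I_d -> K, B (\sum_i c i *: b i) -> forall i, c i = 0].

Definition findimq A B : Prop := exists d, is_dimq A B d.

Definition dimq A B : nat :=
  if pselect (findimq A B) is left fin then sval (cid fin) else 0.

End Dimension.

Definition weighted_homogeneous (K : fieldType) (n : nat) (f : {mpoly K[n]}) :=
  exists (w : 'I_n -> rat) (W : rat),
    (forall j, 0 < w j) /\
    (forall m, m \in msupp f -> \sum_j (m j)%:R * w j = W).

(* The origin is a singular point of V(f), and the only one near the origin.  *)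
Definition isolated_singularity (K : numFieldType) (n : nat)
    (f : {mpoly K[n]}) :=
  let singular (x : 'I_n -> K) :=
    f.@[x] = 0 /\ forall i, (f^`M(i)).@[x] = 0 in
  singular (fun=> 0) /\
  exists2 e : K, 0 < e &
    forall x : 'I_n -> K,
      (forall i, `|x i| < e) -> singular x -> forall i, x i = 0.

(* For p = 0, the value is 0.                                                 *)
Definition multiplicity (K : fieldType) (n : nat) (p : {mpoly K[n]}) : nat :=
  \big[minn/msize p]_(m <- msupp p) mdeg m.

Section HigherMilnorTjurina.
Context (K : fieldType) (n : nat) (f : {mpoly K[n]}).

Definition ps_maxideal : {mpseries K[n]} -> Prop := fun p => p 0%MM = 0.

Definition jacobian_ideal : {mpseries K[n]} -> Prop :=
  ideal_gen (fun p => exists i : 'I_n, p = mpseries_of f^`M(i)).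

Definition milnor_ideal (k : nat) : {mpseries K[n]} -> Prop :=
  ideal_mul (ideal_exp ps_maxideal k) jacobian_ideal.

Definition tjurina_ideal (k : nat) : {mpseries K[n]} -> Prop :=
  ideal_add (ideal_gen (fun p => p = mpseries_of f)) (milnor_ideal k).

Definition milnor (k : nat) : nat := dimq (fun=> True) (milnor_ideal k).
Definition tjurina (k : nat) : nat := dimq (fun=> True) (tjurina_ideal k).

End HigherMilnorTjurina.

Section GapModules.
Context (K : fieldType) (n : nat) (f : {mpoly K[n]}).

Local Notation P := {mpoly K[n]}.
Local Notation Pmu := {poly {mpoly K[n]}}.

Definition ltpair : Type := {p : 'I_n * 'I_n | (p.1 < p.2)%N}.
HB.instance Definition _ := Finite.on ltpair.

Definition mij (i j : 'I_n) : nat :=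
  minn (multiplicity f^`M(i)) (multiplicity f^`M(j)).

(* P[mu] is {poly P}, with mu = 'X. An element u of E2, resp. E2mu, stands for
   \sum_(i < j) u (i, j) v_(i, j), and a row vector for \sum_i u_i v_i.       *)
Local Notation E2 := {ffun ltpair -> P}.
Local Notation E2mu := {ffun ltpair -> Pmu}.
Local Notation E1mu := 'rV[Pmu]_n.

(* p(mu x_1, ..., mu x_n)                                                     *)
Definition dilate (p : P) : Pmu :=
  mmap (fun c => (c%:MP)%:P) (fun i => 'X * ('X_i)%:P) p.

(* The entries are divisible by mu^(m_(i, j)), so drop_poly divides exactly.  *)
Definition Tmu (i j : 'I_n) : E1mu :=
  map_mx (drop_poly (mij i j))
    (dilate f^`M(i) *: delta_mx 0 j - dilate f^`M(j) *: delta_mx 0 i).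

Definition Delta2 (u : E2mu) : E1mu :=
  \sum_(p : ltpair) u p *: Tmu (val p).1 (val p).2.

(* The class of u lies in the kernel of E2[mu]/<mu^l> -> E1[mu]/<mu^l>.       *)
Definition Ztilde (l : nat) (u : E2mu) : Prop :=
  exists w : E1mu, Delta2 u = 'X^l *: w.

Definition mod_mu (u : E2mu) : E2 := [ffun p => (u p)`_0].

Definition Z (l : nat) (z : E2) : Prop :=
  exists2 u : E2mu, Ztilde l u & mod_mu u = z.

Definition Zinf (z : E2) : Prop := forall l, (1 <= l)%N -> Z l z.

Definition gap_number (l : nat) : Prop :=
  (1 <= l)%N /\ ~ (forall z, Z l z <-> Z l.+1 z).

Definition E2_deg (d : nat) (u : E2) : Prop :=
  forall (p : ltpair) (m : 'X_{1..n}),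
    m \in msupp (u p) -> (mdeg m + mij (val p).1 (val p).2 = d)%N.

(* The Hilbert-Poincare series of A / B, for graded submodules B of A of E2.  *)
Definition hilbert_series (A B : E2 -> Prop) : {mpseries rat[1]} :=
  genseries (fun d =>
    dimq (fun u => A u /\ E2_deg d u) (fun u => B u /\ E2_deg d u)).

Definition hilbert_Zinf : {mpseries rat[1]} :=
  hilbert_series Zinf (fun z => z = 0).

Definition hilbert_gap (l : nat) : {mpseries rat[1]} :=
  hilbert_series (Z l) (Z l.+1).

End GapModules.

(* Main.v *)
Require Import Defs.
From HB Require Import structures.
From mathcomp Require Import all_boot all_order all_algebra.
From mathcomp Require Import boolp classical_sets reals complex.
From mathcomp.multinomials Require Import mpoly.
From mathcomp Require Import zify ring lra.

(** Write O for the power series ring, m for its maximal ideal, f_1, ..., f_n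
    for the partial derivatives of f, J for the ideal that they generate, and
    N(k) for the dimension of O/m^k, the number of monomials of degree < k.

    Two facts about J carry the proof. First, J contains a power of every
    variable: weighted homogeneity spreads the absence of singular points near
    the origin to the whole space (isolated_zero), and the Nullstellensatz
    applies (nullstellensatz, jacobian_powers). It is proved here by adjoining
    one equation x_i = c at a time to an ideal that contains no power of h;
    some c works because the base field is uncountable while polynomials have
    countable dimension. In particular every O/m^k J has finite dimension.
    Second, all relations between f_1, ..., f_n are combinations of the trivial
    ones f_i v_j - f_j v_i (syzygy). Indeed J contains the regular sequence
    x_1^N, ..., x_n^N, as long as the sequence of the f_i, which forces the
    Koszul homology of the f_i to vanish in positive degrees
    (koszul_exact_mod).

    The module J/m^k J is the quotient of O^n by m^k O^n and the relations, that
    is, by m^k O^n and the image of the map Delta sending v_(i,j) to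
    f_i v_j - f_j v_i. So its dimension is n N(k) minus the dimension of the
    source of Delta modulo the preimage of m^k O^n. Give v_(i,j) the degree
    m_(i,j), the smaller of the orders of f_i and f_j. The preimage contains all
    elements of order >= k, which have codimension the sum of the N(k - m_(i,j)),
    and the rest of it is counted by leading forms. An element of order d in the
    preimage is one whose image has order at least k - d above the order d that
    is automatic, and the parameter mu of the definition of Z_l records exactly
    this excess: the leading forms are the elements of degree d of Z_(k-d)
    (Z_lead_form, Z_lift). This gives milnor_formula:
      mu_k = mu_0 + n N(k) - sum_(i<j) N(k - m_(i,j))
             + sum_(d<k) dim (Z_(k-d))_d.
    Filtering Z_l by its gaps (dimZ_gaps) and summing over k gives the first
    series.

    For the second, Euler's identity puts f in mJ, so multiplication by f maps O
    onto (f, m^k J)/m^k J. Its kernel is m^(k-1), by comparison of orders: the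
    order of gf is the sum of those of g and f, while J has no element of order
    below ord f - 1 (colon_milnor). Hence mu_k - tau_k = N(k-1), which is the
    coefficient of t^k in t^2/(1-t)^(n+1). *)

Set Implicit Arguments.
Unset Strict Implicit.
Unset Printing Implicit Defensive.
Import Order.TTheory GRing.Theory Num.Theory.

Local Open Scope ring_scope.

(** * Dimensions of quotients of subspaces *)

Section Dim.
Context (K : fieldType).

Definition subspace (V : lmodType K) (A : V -> Prop) :=
  A 0 /\ forall (a : K) u v, A u -> A v -> A (a *: u + v).

Section Subspace.
Context (V : lmodType K) (A : V -> Prop) (sA : subspace A).

Lemma subspace0 : A 0. Proof. by case: sA. Qed.
Lemma subspaceZ a u : A u -> A (a *: u).
Proof. by case: sA => A0 AD Au; rewrite -[_ *: _]addr0; exact: AD. Qed.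
Lemma subspaceD u v : A u -> A v -> A (u + v).
Proof. by case: sA => A0 AD Au Av; rewrite -[u]scale1r; exact: AD. Qed.
Lemma subspaceB u v : A u -> A v -> A (u - v).
Proof. by move=> Au Av; rewrite -scaleN1r; apply: subspaceD => //; apply: subspaceZ. Qed.
Lemma subspace_sum (I : Type) (s : seq I) (P : pred I) (F : I -> V) :
  (forall i, P i -> A (F i)) -> A (\sum_(i <- s | P i) F i).
Proof. by move=> h; elim/big_ind: _ => //; [exact: subspace0 | exact: subspaceD]. Qed.
Lemma subspace_comb (I : finType) (c : I -> K) (b : I -> V) :
  (forall i, A (b i)) -> A (\sum_i c i *: b i).
Proof. by move=> h; apply: subspace_sum => i _; apply: subspaceZ. Qed.

End Subspace.

Lemma subspaceI (V : lmodType K) (A B : V -> Prop) :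
  subspace A -> subspace B -> subspace (fun v => A v /\ B v).
Proof.
move=> sA sB; split=> [|a u v [Au Bu] [Av Bv]]; first by split; exact: subspace0.
by split; [apply: sA.2 | apply: sB.2].
Qed.

Lemma subspace_preim (V W : lmodType K) (h : {linear V -> W}) (B : W -> Prop) :
  subspace B -> subspace (fun v => B (h v)).
Proof.
move=> sB; split=> [|a u v Bu Bv]; first by rewrite linear0; exact: subspace0.
by rewrite linearP; apply: sB.2.
Qed.

Lemma subspace_eq0 (V : lmodType K) : subspace (fun v : V => v = 0).
Proof. by split=> [//|a u v -> ->]; rewrite scaler0 addr0. Qed.

Definition indep (V : lmodType K) (B : V -> Prop) (d : nat) (b : 'I_d -> V) :=
  forall c : 'I_d -> K, B (\sum_i c i *: b i) -> forall i, c i = 0.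

Section Dimq.
Context (V : lmodType K).
Implicit Types (A B C : V -> Prop).

(** The coordinates of the family in a basis of the quotient form a matrix with
    more rows than columns if e > d, and a row vector in its kernel is a
    relation modulo B. *)
Lemma indep_leq A B d e (b : 'I_e -> V) :
  subspace B -> is_dimq A B d -> (forall i, A (b i)) -> indep B b -> (e <= d)%N.
Proof.
move=> sB [b0 [Ab0 gen _]] Ab ind; rewrite leqNgt; apply/negP => de.
have /choice [M0 M0P] i := gen _ (Ab i).
pose M : 'M[K]_(e, d) := \matrix_(i, j) M0 i j.
have : ~~ row_free M.
  by rewrite /row_free neq_ltn (leq_ltn_trans (rank_leq_col M)).
rewrite -kermx_eq0 => /rowV0Pn [u /sub_kermxP uM /negP]; apply; apply/eqP.
apply/rowP => i; rewrite mxE; apply: (ind (fun i => u 0 i)) => {i}.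
have -> : \sum_i u 0 i *: b i = \sum_i u 0 i *: (b i - \sum_j M0 i j *: b0 j).
  have -> : \sum_i u 0 i *: (b i - \sum_j M0 i j *: b0 j)
     = \sum_i u 0 i *: b i - \sum_i u 0 i *: \sum_j M0 i j *: b0 j.
    by rewrite -sumrB; apply: eq_bigr => i _; rewrite scalerBr.
  rewrite [X in _ = _ - X](_ : _ = 0) ?subr0 //.
  under eq_bigr do rewrite scaler_sumr.
  rewrite exchange_big big1 //= => j _.
  have := congr1 (fun m : 'rV_d => m 0 j) uM; rewrite !mxE => uMj.
  under eq_bigr do rewrite scalerA.
  rewrite -scaler_suml -[RHS](scale0r (b0 j)); congr (_ *: _).
  by rewrite -[RHS]uMj; apply: eq_bigr => i _; rewrite mxE.
by apply: subspace_comb.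
Qed.

Lemma is_dimq_uniq A B d e :
  subspace B -> is_dimq A B d -> is_dimq A B e -> d = e.
Proof.
move=> sB dA eA; apply/eqP; rewrite eqn_leq.
by apply/andP; split; [case: dA => b [] | case: eA => b []] => *; exact: (@indep_leq A B).
Qed.

Lemma dimqE A B d : subspace B -> is_dimq A B d -> dimq A B = d.
Proof.
move=> sB dA; rewrite /dimq; case: pselect => [fin|[]]; last by exists d.
by case: (cid fin) => e /= eA; exact: (is_dimq_uniq sB eA dA).
Qed.

Lemma dimqP A B : findimq A B -> is_dimq A B (dimq A B).
Proof. by rewrite /dimq; case: pselect => // fin _; case: (cid fin). Qed.

Lemma dimq_iff A A' B B' :
  (forall v, A v <-> A' v) -> (forall v, B v <-> B' v) -> dimq A B = dimq A' B'.
Proof.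
move=> AA BB; have -> : A = A' by apply/funext => v; apply/propext.
by have -> : B = B' by apply/funext => v; apply/propext.
Qed.

Lemma is_dimq_add A B C d e :
  subspace A -> subspace B -> (forall v, C v -> B v) -> (forall v, B v -> A v) ->
  is_dimq A B d -> is_dimq B C e -> is_dimq A C (d + e).
Proof.
move=> sA sB CB BA [b [Ab gb ib]] [c [Bc gc ic]].
exists (fun i => match split i with inl i => b i | inr j => c j end); split.
- by move=> i; case: split => j; [exact: Ab | exact/BA/Bc].
- move=> v Av; have [x xP] := gb v Av; have [y yP] := gc _ xP.
  exists (fun i => match split i with inl i => x i | inr j => y j end).
  rewrite big_split_ord /= opprD addrA.
  under [X in v - X - _]eq_bigr do rewrite (unsplitK (inl _)).
  by under [X in _ - _ - X]eq_bigr do rewrite (unsplitK (inr _)).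
- move=> x; rewrite big_split_ord /=.
  under eq_bigr do rewrite (unsplitK (inl _)).
  under [X in _ + X]eq_bigr do rewrite (unsplitK (inr _)).
  move=> Cx.
  have x0 : forall i, x (lshift e i) = 0.
    apply: ib; rewrite -[X in B X](addrK (\sum_i x (rshift d i) *: c i)).
    by apply: subspaceB => //; [apply: CB | apply: subspace_comb].
  have y0 : forall i, x (rshift d i) = 0.
    by apply: ic; move: Cx; rewrite big1 ?add0r // => i _; rewrite x0 scale0r.
  by move=> i; rewrite -(splitK i); case: split => j /=.
Qed.

(** An independent family of maximal length is a basis: a vector outside its
    span would extend it. *)
Lemma findimq_bounded A B d :
  subspace A -> subspace B ->
  (forall e (b : 'I_e -> V), (forall i, A (b i)) -> indep B b -> (e <= d)%N) ->
  findimq A B.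
Proof.
move=> sA sB bnd.
have ex : exists e, `[< exists b : 'I_e -> V, (forall i, A (b i)) /\ indep B b >].
  by exists 0; apply/asboolP; exists (fun=> 0); split=> [i|c _ []//]; exact: subspace0.
have bnd' e : `[< exists b : 'I_e -> V, (forall i, A (b i)) /\ indep B b >] -> (e <= d)%N.
  by case/asboolP => b [Ab ib]; exact: bnd ib.
have [e /asboolP [b [Ab ib]] emax] := ex_maxnP ex bnd'.
exists e, b; split=> // v Av; apply: contrapT => nv.
suff : (e.+1 <= e)%N by rewrite ltnn.
apply: emax; apply/asboolP.
exists (fun i => if unlift ord0 i is Some j then b j else v); split.
  by move=> i; case: unlift.
move=> c; rewrite big_ord_recl unlift_none.
under eq_bigr do rewrite liftK.
move=> Bc; have c0 : c ord0 = 0.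
  apply/eqP/negPn/negP => c0; apply: nv.
  exists (fun i => - (c ord0)^-1 * c (lift ord0 i)).
  have := subspaceZ sB (c ord0)^-1 Bc; rewrite scalerDr scalerA mulVf // scale1r.
  rewrite scaler_sumr -sumrN; congr (B (_ + _)); apply: eq_bigr => i _.
  by rewrite scalerA mulNr scaleNr opprK.
move: Bc; rewrite c0 scale0r add0r => /ib ci i.
by case: (unliftP ord0 i) => [j ->|->].
Qed.

Lemma findimq_quot A B C :
  subspace A -> subspace B -> subspace C ->
  (forall v, C v -> B v) -> findimq A C -> findimq A B.
Proof.
move=> sA sB sC CB [d dA]; apply: (@findimq_bounded _ _ d) => // e b Ab ib.
by apply: (@indep_leq A C _ _ b) => // c Cc; apply: ib; apply: CB.
Qed.

Lemma findimq_sub A B C :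
  subspace B -> subspace C -> (forall v, B v -> A v) ->
  findimq A C -> findimq B C.
Proof.
move=> sB sC BA [d dA]; apply: (@findimq_bounded _ _ d) => // e b Bb ib.
by apply: (@indep_leq A C _ _ b) => // i; apply: BA.
Qed.

Lemma dimq_add A B C :
  subspace A -> subspace B -> subspace C ->
  (forall v, C v -> B v) -> (forall v, B v -> A v) ->
  findimq A C -> dimq A C = (dimq A B + dimq B C)%N.
Proof.
move=> sA sB sC CB BA fin; apply: dimqE => //.
apply: (@is_dimq_add _ B) => //; apply: dimqP.
  exact: (findimq_quot _ _ sC).
exact: (findimq_sub _ _ BA).
Qed.

Lemma dimq_refl A : subspace A -> dimq A A = 0%N.
Proof.
move=> sA; apply: dimqE => //; exists (fun=> 0); split=> [i|v Av|c _ []//].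
  exact: subspace0.
by exists (fun=> 0); rewrite big_ord0 subr0.
Qed.

(** Dimension by coordinates: if finitely many linear functionals can take all
    values on A and vanish together exactly on B, they count the dimension. *)
Lemma is_dimq_coord A B (T : finType) (x : T -> V -> K) :
  subspace A ->
  (forall t a u v, x t (a *: u + v) = a * x t u + x t v) ->
  (forall c : T -> K, exists2 v, A v & forall t, x t v = c t) ->
  (forall v, A v -> (B v <-> forall t, x t v = 0)) ->
  is_dimq A B #|T|.
Proof.
move=> sA xlin sur Bx.
have /choice [b bP] (t : T) : exists v, A v /\ forall s, x s v = (s == t)%:R.
  by have [v Av vt] := sur (fun s => (s == t)%:R); exists v.
have x0 t : x t 0 = 0.
  by have := xlin t (-1) 0 0; rewrite scaler0 addr0 mulN1r addNr.
have xsum (c : 'I_#|T| -> K) t :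
    x t (\sum_i c i *: b (enum_val i)) = c (enum_rank t).
  have -> : x t (\sum_i c i *: b (enum_val i))
      = \sum_i c i * x t (b (enum_val i)).
    apply: (big_rec2 (fun u v => x t u = v)) => [|i u v _ <-]; [exact: x0|exact: xlin].
  rewrite (bigD1 (enum_rank t)) //= (bP _).2 enum_rankK eqxx mulr1 big1 ?addr0 //.
  move=> i it; rewrite (bP _).2 [_ == _](_ : _ = false) ?mulr0 //.
  by apply: contraNF it => /eqP ->; rewrite enum_valK.
exists (fun i => b (enum_val i)); split=> [i|v Av|c Bc i].
- exact: (bP _).1.
- exists (fun i => x (enum_val i) v).
  have Ab : A (\sum_(i < #|T|) x (enum_val i) v *: b (enum_val i)).
    by apply: subspace_comb => // i; exact: (bP _).1.
  apply/Bx; first exact: subspaceB.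
  by move=> t; rewrite addrC -scaleN1r xlin xsum enum_rankK mulN1r addNr.
- move/Bx: Bc => xc; rewrite -(enum_valK i) -xsum xc //.
  by apply: subspace_comb => // j; exact: (bP _).1.
Qed.

End Dimq.

(** The hypotheses say that h induces an isomorphism from A/B to A'/B'. All
    isomorphism theorems used below are instances. *)
Lemma is_dimq_linear (V W : lmodType K) (A B : V -> Prop) (A' B' : W -> Prop)
    (h : {linear V -> W}) d :
  subspace A -> subspace B' ->
  (forall v, A v -> A' (h v)) ->
  (forall w, A' w -> exists2 v, A v & B' (w - h v)) ->
  (forall v, A v -> (B v <-> B' (h v))) ->
  is_dimq A B d -> is_dimq A' B' d.
Proof.
move=> sA sB' hA sur hB [b [Ab gen ind]].
have hsum (c : 'I_d -> K) : h (\sum_i c i *: b i) = \sum_i c i *: h (b i).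
  by rewrite linear_sum; apply: eq_bigr => i _; rewrite linearZ.
exists (fun i => h (b i)); split=> [i|w A'w|c Bc]; first exact: hA.
  have [v Av wv] := sur w A'w; have [c Bc] := gen v Av; exists c.
  have -> : w - \sum_i c i *: h (b i) = (w - h v) + h (v - \sum_i c i *: b i).
    by rewrite linearB /= hsum addrA subrK.
  apply: subspaceD => //; apply/hB => //; apply: subspaceB => //.
  by apply: subspace_comb.
by apply: ind; apply/hB; rewrite ?hsum //; apply: subspace_comb.
Qed.

Lemma dimq_linear (V W : lmodType K) (A B : V -> Prop) (A' B' : W -> Prop)
    (h : {linear V -> W}) :
  subspace A -> subspace B -> subspace B' -> findimq A B ->
  (forall v, A v -> A' (h v)) ->
  (forall w, A' w -> exists2 v, A v & B' (w - h v)) ->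
  (forall v, A v -> (B v <-> B' (h v))) ->
  findimq A' B' /\ dimq A B = dimq A' B'.
Proof.
move=> sA sB sB' fin hA sur hB.
have := is_dimq_linear sA sB' hA sur hB (dimqP fin).
by move=> dd; split; [eexists; exact: dd | rewrite (dimqE _ dd)].
Qed.

End Dim.

(** * Power series, orders and powers of the variables *)

Section Series.
Context (K : fieldType) (n : nat).
Local Notation O := {mpseries K[n]}.
Implicit Types (p q a : O) (k : nat) (m : 'X_{1..n}).

(** The power m^k of the maximal ideal, by coefficients; see [ideal_exp_maxP].
    *)
Definition ordge k p := forall m, (mdeg m < k)%N -> p m = 0.

Lemma ps_coefXM u p m :
  (mpseries_of 'X_[u] * p) m = if (u <= m)%MM then p (m - u)%MM else 0.
Proof.
rewrite (ps_coefM_trunc _ _ (ltnSn _)).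
have agree v : (mdeg v <= mdeg m)%N ->
    (ps_trunc (mdeg m).+1 (mpseries_of 'X_[u] : O))@_v = ('X_[u] : {mpoly K[n]})@_v.
  by move=> vm; rewrite ps_truncE ?ltnS.
rewrite (mcoeffM_agree (d := ps_trunc (mdeg m).+1 p) agree) //.
set q := ps_trunc _ p; rewrite mulrC; case: ifP => um.
  by rewrite -[X in _@_X](submK um) addmC mcoeffMX /q ps_truncE // ltnS mdegB.
apply/eqP; apply: contraFT um; rewrite -mcoeff_msupp => h.
have := msuppM_le h; case/allpairsP => -[v w] /= [_].
by rewrite msuppX inE => /eqP -> ->; apply: lem_addl.
Qed.

Lemma ordge_leq k k' p : (k' <= k)%N -> ordge k p -> ordge k' p.
Proof. by move=> kk h m mk; apply: h; apply: leq_trans mk kk. Qed.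

Lemma subspace_ordge k : subspace (ordge k).
Proof.
split=> [//|c p q hp hq m mk]; by rewrite ps_coefD ps_coefZ hp ?hq ?mulr0 ?addr0.
Qed.

Lemma ordge0 k : ordge k 0. Proof. exact: subspace0 (subspace_ordge k). Qed.
Lemma ordgeD k p q : ordge k p -> ordge k q -> ordge k (p + q).
Proof. exact: (subspaceD (subspace_ordge k)). Qed.
Lemma ordgeB k p q : ordge k p -> ordge k q -> ordge k (p - q).
Proof. exact: (subspaceB (subspace_ordge k)). Qed.
Lemma ordge_sum k (I : Type) (s : seq I) (P : pred I) (F : I -> O) :
  (forall i, P i -> ordge k (F i)) -> ordge k (\sum_(i <- s | P i) F i).
Proof. exact: (subspace_sum (subspace_ordge k)). Qed.

Lemma ordgeM k l p q : ordge k p -> ordge l q -> ordge (k + l) (p * q).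
Proof.
move=> hp hq m mkl; rewrite ps_coefM big1 // => -[u v] /= /eqP muv.
have [uk|uk] := ltnP (mdeg u) k; first by rewrite hp ?mul0r.
have mD : mdeg m = (mdeg u + mdeg v)%N by rewrite -mdegD -muv.
rewrite [q _]hq ?mulr0 // -(ltn_add2l (mdeg u)); apply: leq_ltn_trans (_ : (mdeg m < _)%N).
  by rewrite [leqRHS]mD.
by apply: leq_trans mkl _; rewrite leq_add2r.
Qed.

Lemma ordgeMl k p q : ordge k q -> ordge k (p * q).
Proof. exact: (@ordgeM 0). Qed.
Lemma ordgeMr k p q : ordge k p -> ordge k (p * q).
Proof. by move=> h; rewrite mulrC; apply: ordgeMl. Qed.

Section Powers.
Context (N : nat).

Definition Xpow (i : 'I_n) : O := mpseries_of 'X_[U_(i) *+ N].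

(** The ideal generated by the first r of the powers x_i^N. *)
Definition pow_ideal (r : nat) (p : O) :=
  forall m, (forall i : 'I_n, (i < r)%N -> (m i < N)%N) -> p m = 0.

(** The quotient of the division by x_i^N, monomial by monomial. *)
Definition Xquo (i : 'I_n) (p : O) : O := MPSeries (fun m => p (m + U_(i) *+ N)%MM).

Lemma subspace_pow_ideal r : subspace (pow_ideal r).
Proof.
split=> [//|c p q hp hq m mk]; by rewrite ps_coefD ps_coefZ hp ?hq ?mulr0 ?addr0.
Qed.

Lemma pow_idealM r a p : pow_ideal r p -> pow_ideal r (a * p).
Proof.
move=> hp m hm; rewrite ps_coefM big1 // => -[u v] /= /eqP muv.
rewrite [p _]hp ?mulr0 // => i ir; apply: leq_ltn_trans (hm i ir).
by have -> : m i = (u i + v i)%N; [rewrite -mnmDE -muv | exact: leq_addl].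
Qed.

Lemma pow_ideal0 p : pow_ideal 0 p -> p = 0.
Proof. by move=> h; apply: mpseriesP => m; rewrite h. Qed.

Lemma mnm_pow (i j : 'I_n) : (U_(i) *+ N)%MM j = if i == j then N else 0%N.
Proof. by rewrite mulmnE mnm1E; case: eqP; rewrite ?mul1n ?mul0n. Qed.

Lemma pow_lem (i : 'I_n) m : (U_(i) *+ N <= m)%MM = (N <= m i)%N.
Proof.
apply/mnm_lepP/idP => [/(_ i)|h j]; rewrite mnm_pow; first by rewrite eqxx.
by case: eqP => // <-.
Qed.

(** Division by x_i^N removes all the monomials that x_i^N divides. *)
Lemma pow_ideal_quo (i : 'I_n) p :
  pow_ideal i.+1 p -> pow_ideal i (p - Xpow i * Xquo i p).
Proof.
move=> hp m hm; rewrite ps_coefB ps_coefXM pow_lem.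
case: leqP => mi /=; first by rewrite submK ?pow_lem ?subrr.
rewrite subr0 hp // => j; rewrite ltnS leq_eqVlt => /orP[/eqP ji|]; last exact: hm.
by rewrite (val_inj ji).
Qed.

Lemma pow_ideal_reg (i : 'I_n) p : pow_ideal i (Xpow i * p) -> pow_ideal i p.
Proof.
move=> hp m hm; have := hp (m + U_(i) *+ N)%MM.
rewrite ps_coefXM pow_lem mnmDE mnm_pow eqxx leq_addl addmK; apply=> j ji.
by rewrite mnmDE mnm_pow eq_sym [_ == _](_ : _ = false) ?addn0 ?hm // -val_eqE /= ltn_eqF.
Qed.

Lemma mdeg_pow (i : 'I_n) : mdeg (U_(i) *+ N)%MM = N.
Proof. by rewrite mdegMn mdeg1 mul1n. Qed.

Lemma ordge_Xpow i : ordge N (Xpow i).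
Proof.
move=> m mN; rewrite /= mcoeffX; case: eqP => // e.
by move: mN; rewrite -e mdeg_pow ltnn.
Qed.

Lemma Xquo0 i : Xquo i 0 = 0. Proof. exact: mpseriesP. Qed.

(** The decomposition is monomial, obtained by dividing successively by the
    powers x_i^N, so each division lowers the order by at most N. For N = 1
    this writes an element of m^(k+1) as a combination of the variables with
    coefficients in m^k. *)
Lemma pow_ideal_decomp p k : pow_ideal n p -> ordge k p ->
  exists a : 'I_n -> O,
    (forall i, ordge (k - N) (a i)) /\ p = \sum_i Xpow i * a i.
Proof.
have [r rn ->] : exists2 r, (r <= n)%N & pow_ideal n = pow_ideal r by exists n.
elim: r rn p => [|r IH] rn p hp kp.
  exists (fun=> 0); split; first by move=> i; exact: ordge0.
  by rewrite (pow_ideal0 hp) big1 // => i _; rewrite mulr0.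
pose i := Ordinal rn.
have kq : ordge (k - N) (Xquo i p).
  by move=> m mk /=; rewrite kp // mdegD mdeg_pow -ltn_subRL ltn_subCr.
have kp' : ordge k (p - Xpow i * Xquo i p).
  apply: ordgeB => //; apply: (@ordge_leq (N + (k - N))); first by rewrite -maxnE leq_maxr.
  exact: ordgeM (ordge_Xpow i) kq.
have [a [ka ap]] := IH (ltnW rn) _ (pow_ideal_quo (hp : pow_ideal i.+1 p)) kp'.
exists (fun j => a j + (if j == i then Xquo i p else 0)); split=> [j|].
  by apply: ordgeD => //; case: ifP => // _; exact: ordge0.
under eq_bigr do rewrite mulrDr.
rewrite big_split -ap (bigD1 i) //= eqxx [X in _ + (_ + X)]big1 ?addr0 ?subrK //.
by move=> j /negbTE ->; rewrite mulr0.
Qed.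

End Powers.

Lemma ideal_gen_closed (S I : O -> Prop) : subspace I ->
  (forall a p, I p -> I (a * p)) -> (forall p, S p -> I p) ->
  forall p, ideal_gen S p -> I p.
Proof.
move=> sI Imul SI p [s [sS ->]]; rewrite big_seq.
by apply: (subspace_sum sI) => q qs; apply/Imul/SI/sS.
Qed.

Lemma ideal_gen_sum (S : O -> Prop) (I : finType) (a b : I -> O) :
  (forall i, S (b i)) -> ideal_gen S (\sum_i a i * b i).
Proof.
move=> Sb; exists [seq (a i, b i) | i <- index_enum I]; split.
  by move=> q /mapP[i _ ->]; exact: Sb.
by rewrite big_map.
Qed.

Lemma ideal_exp_maxP k p : ideal_exp (@ps_maxideal K n) k p <-> ordge k p.
Proof.
elim: k p => [|k IH] p /=; first by split.
split.
  apply: ideal_gen_closed; first exact: subspace_ordge.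
    by move=> a q; exact: ordgeMl.
  move=> _ [a [b [a0 /IH kb ->]]]; apply: (@ordgeM 1) => // m.
  by rewrite ltnS leqn0 mdeg_eq0 => /eqP ->.
move=> kp; have mp : pow_ideal 1 n p.
  move=> m hm; rewrite kp // (_ : m = 0%MM) ?mdeg0 //.
  by apply/mnmP => i; rewrite mnm0E; apply/eqP; rewrite -leqn0 -ltnS hm.
have [a [ka ->]] := pow_ideal_decomp mp kp.
have -> : \sum_i Xpow 1 i * a i = \sum_i 1 * (Xpow 1 i * a i).
  by apply: eq_bigr => i _; rewrite mul1r.
apply: ideal_gen_sum => i; exists (Xpow 1 i), (a i); split=> //.
  by rewrite /ps_maxideal (ordge_Xpow (N := 1)) // mdeg0.
by apply/IH; have := ka i; rewrite subn1.
Qed.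

End Series.

(** * The Koszul complex and regular sequences *)

Section Koszul.
Context (A : comNzRingType).

(** The Koszul complex on n elements as an iterated mapping cone: the pair (a,
    b) stands for a + e_n b, where e_n is the exterior generator of the last
    element. This recursion replaces the usual sign conventions on subsets. *)
Fixpoint kos (n : nat) : lmodType A :=
  if n is n'.+1 then (kos n' * kos n')%type : lmodType A else A^o.

Section Differential.
Context (f : nat -> A).

Fixpoint kdiff (n : nat) : kos n -> kos n :=
  match n return kos n -> kos n with
  | 0 => fun=> 0
  | n'.+1 => fun x : kos n'.+1 => (kdiff x.1 + f n' *: x.2, - kdiff x.2) : kos n'.+1
  end.

(** Exterior multiplication by the j-th generator. *)
Fixpoint khom (j n : nat) : kos n -> kos n :=
  match n return kos n -> kos n with
  | 0 => fun=> 0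
  | n'.+1 => fun x : kos n'.+1 =>
      (if j == n' then (0, x.1) else (khom j x.1, - khom j x.2)) : kos n'.+1
  end.

Fixpoint kdeg (n i : nat) : kos n -> Prop :=
  match n return kos n -> Prop with
  | 0 => fun x : A => i != 0%N -> x = 0
  | n'.+1 => fun x : kos n'.+1 =>
     kdeg i x.1 /\ (if i is i'.+1 then kdeg i' x.2 else x.2 = 0)
  end.

Lemma kdiff_linear n (c : A) (x y : kos n) : kdiff (c *: x + y) = c *: kdiff x + kdiff y.
Proof.
elim: n x y => [|n IH] x y /=; first by rewrite scaler0 addr0.
rewrite !IH; congr (_, _) => /=; last by rewrite scalerN opprD.
by rewrite !scalerDr !scalerA [f n * c]mulrC -!addrA; congr (_ + _); rewrite addrCA.
Qed.

Lemma kdiffD n (x y : kos n) : kdiff (x + y) = kdiff x + kdiff y.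
Proof. by rewrite -[x]scale1r kdiff_linear !scale1r. Qed.
Lemma kdiff0 n : kdiff (0 : kos n) = 0.
Proof. by have := kdiffD (0 : kos n) 0; rewrite addr0 => /eqP; rewrite -subr_eq subrr => /eqP. Qed.
Lemma kdiffZ n c (x : kos n) : kdiff (c *: x) = c *: kdiff x.
Proof. by rewrite -[c *: x]addr0 kdiff_linear kdiff0 addr0. Qed.
Lemma kdiffN n (x : kos n) : kdiff (- x) = - kdiff x.
Proof. by rewrite -scaleN1r kdiffZ scaleN1r. Qed.
Lemma kdiffB n (x y : kos n) : kdiff (x - y) = kdiff x - kdiff y.
Proof. by rewrite kdiffD kdiffN. Qed.

Lemma kdiffK n (x : kos n) : kdiff (kdiff x) = 0.
Proof.
elim: n x => [|n IH] x; first by [].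
case: x => a b /=.
by rewrite kdiffD kdiffZ kdiffN !IH add0r scalerN subrr !oppr0.
Qed.

Lemma khom_linear j n (c : A) (x y : kos n) :
  khom j (c *: x + y) = c *: khom j x + khom j y.
Proof.
elim: n x y => [|n IH] x y /=; first by rewrite scaler0 addr0.
case: ifP => _; last by rewrite !IH opprD -scalerN.
by congr (_, _) => /=; rewrite scaler0 addr0.
Qed.

Lemma khomD j n (x y : kos n) : khom j (x + y) = khom j x + khom j y.
Proof. by rewrite -[x]scale1r khom_linear !scale1r. Qed.
Lemma khom0 j n : khom j (0 : kos n) = 0.
Proof. by have := khomD j (0 : kos n) 0; rewrite addr0 => /eqP; rewrite -subr_eq subrr => /eqP. Qed.
Lemma khomZ j n c (x : kos n) : khom j (c *: x) = c *: khom j x.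
Proof. by rewrite -[c *: x]addr0 khom_linear khom0 addr0. Qed.
Lemma khomN j n (x : kos n) : khom j (- x) = - khom j x.
Proof. by rewrite -scaleN1r khomZ scaleN1r. Qed.

(** Cartan's formula: multiplication by f_j is homotopic to zero. *)
Lemma kdiff_khom j n (x : kos n) : (j < n)%N ->
  kdiff (khom j x) + khom j (kdiff x) = f j *: x.
Proof.
elim: n x => [|n IH] x; first by [].
case: x => a b /=; rewrite ltnS leq_eqVlt; case: eqP => [-> _|_ /= jn].
  congr (_, _) => /=; first by rewrite kdiff0 add0r addr0.
  by rewrite addrA addNr add0r.
congr (_, _) => /=.
  by rewrite khomD khomZ scalerN addrA addrAC subrK IH.
by rewrite kdiffN opprK khomN opprK IH.
Qed.

Lemma kdeg_linear n i c (x y : kos n) : kdeg i x -> kdeg i y -> kdeg i (c *: x + y).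
Proof.
elim: n i x y => [|n IH] i x y /=.
  by move=> hx hy i0; rewrite hx ?hy // scaler0 addr0.
move=> [x1 x2] [y1 y2]; split; first exact: IH.
by case: i x2 y2 {x1 y1} => [-> ->|i]; [rewrite scaler0 addr0 | exact: IH].
Qed.

Lemma kdeg0 n i : kdeg i (0 : kos n).
Proof. by elim: n i => [//|n IH] [|i]; split=> //=; exact: IH. Qed.
Lemma kdegD n i (x y : kos n) : kdeg i x -> kdeg i y -> kdeg i (x + y).
Proof. by move=> hx hy; rewrite -[x]scale1r; exact: kdeg_linear. Qed.
Lemma kdegZ n i c (x : kos n) : kdeg i x -> kdeg i (c *: x).
Proof. by move=> hx; rewrite -[_ *: _]addr0; apply: kdeg_linear => //; exact: kdeg0. Qed.
Lemma kdegN n i (x : kos n) : kdeg i x -> kdeg i (- x).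
Proof. by rewrite -scaleN1r; exact: kdegZ. Qed.

Lemma kdeg0_diff n (x : kos n) : kdeg 0 x -> kdiff x = 0.
Proof.
elim: n x => [|n IH] x; first by [].
case: x => a b /= [ha ->].
by rewrite IH // scaler0 kdiff0 addr0 oppr0.
Qed.

Lemma kdeg_diff n i (x : kos n) : kdeg i.+1 x -> kdeg i (kdiff x).
Proof.
elim: n i x => [|n IH] i x /=; first by [].
move=> [h1 h2]; split; first by apply: kdegD; [exact: IH|exact: kdegZ].
case: i h2 {h1} => [|i] h2; last by apply: kdegN; exact: IH.
by rewrite kdeg0_diff ?oppr0.
Qed.

Lemma kdeg_hom j n i (x : kos n) : kdeg i x -> kdeg i.+1 (khom j x).
Proof.
elim: n i x => [|n IH] i x /=; first by [].
move=> [h1 h2]; case: ifP => _; first by split=> //; exact: kdeg0.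
split; first exact: IH.
apply: kdegN; case: i h2 {h1} => [->|i h2]; last exact: IH.
by rewrite khom0; exact: kdeg0.
Qed.

Lemma kdeg_large n i (x : kos n) : (n < i)%N -> kdeg i x -> x = 0.
Proof.
elim: n i x => [|n IH] [//|i] x ni /=; first by move=> h; rewrite h.
by case: x => a b /= [ha hb]; rewrite (IH _ _ _ ha) ?(IH _ _ _ hb) //; exact: ltnW.
Qed.

End Differential.

Section Ksub.
Context (J : A -> Prop).
Hypothesis (J0 : J 0) (JD : forall a x y, J x -> J y -> J (a * x + y)).

Fixpoint ksub n : kos n -> Prop :=
  match n return kos n -> Prop with
  | 0 => fun x : A => J x
  | n'.+1 => fun x : kos n'.+1 => ksub x.1 /\ ksub x.2
  end.

Lemma ksub_linear n c (x y : kos n) : ksub x -> ksub y -> ksub (c *: x + y).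
Proof.
elim: n x y => [|n IH] x y /=; first exact: JD.
by case=> [? ?] [? ?]; split; exact: IH.
Qed.
Lemma ksub0 n : ksub (0 : kos n).
Proof. by elim: n => [//|n IH] /=. Qed.
Lemma ksubD n (x y : kos n) : ksub x -> ksub y -> ksub (x + y).
Proof. by move=> hx hy; rewrite -[x]scale1r; exact: ksub_linear. Qed.
Lemma ksubZ n c (x : kos n) : ksub x -> ksub (c *: x).
Proof. by move=> hx; rewrite -[_ *: _]addr0; apply: ksub_linear => //; exact: ksub0. Qed.
Lemma ksubN n (x : kos n) : ksub x -> ksub (- x).
Proof. by rewrite -scaleN1r; exact: ksubZ. Qed.
Lemma ksub_diff f n (x : kos n) : ksub x -> ksub (kdiff f x).
Proof.
elim: n x => [|n IH] x; first by move=> _; exact: ksub0.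
case: x => a b /= [ha hb]; split; last by apply: ksubN; exact: IH.
by apply: ksubD; [exact: IH | exact: ksubZ].
Qed.
Lemma ksub_hom j n (x : kos n) : ksub x -> ksub (khom j x).
Proof.
elim: n x => [|n IH] x; first by move=> _; exact: ksub0.
case: x => a b /= [ha hb]; case: ifP => _; split=> //=; first exact: ksub0.
  exact: IH.
by apply: ksubN; exact: IH.
Qed.
End Ksub.

Fixpoint kmap (phi : A -> A) n : kos n -> kos n :=
  match n return kos n -> kos n with
  | 0 => fun x : A => phi x
  | n'.+1 => fun x : kos n'.+1 => (kmap phi x.1, kmap phi x.2) : kos n'.+1
  end.

Lemma kdeg_map (phi : A -> A) n i (x : kos n) :
  phi 0 = 0 -> kdeg i x -> kdeg i (kmap phi x).
Proof.
move=> phi0; have map0 m : kmap phi (0 : kos m) = 0.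
  by elim: m => [|m IH] /=; [rewrite phi0 | rewrite !IH].
elim: n i x => [|n IH] i x /=; first by move=> h i0; rewrite h.
case: x => a b /= [ha hb]; split; first exact: IH.
by case: i hb {ha} => [->|i hb]; [exact: map0 | exact: IH].
Qed.

(** Here I r plays the role of the ideal generated by the first r terms of a
    regular sequence g, phi divides by the r-th term, and w expresses the
    sequence g by the sequence f. *)
Section Depth.
Context (n : nat) (f : nat -> A) (I : nat -> A -> Prop) (g : nat -> A)
  (phi : nat -> A -> A) (w : nat -> nat -> A).
Hypothesis I0 : forall r, I r 0.
Hypothesis ID : forall r a x y, I r x -> I r y -> I r (a * x + y).
Hypothesis phi0 : forall r, phi r 0 = 0.
Hypothesis Iphi : forall r x, (r < n)%N -> I r.+1 x -> I r (x - g r * phi r x).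
Hypothesis Ireg : forall r x, (r < n)%N -> I r (g r * x) -> I r x.
Hypothesis IS : forall r x, (r < n)%N -> I r x -> I r.+1 x.
Hypothesis gI : forall r, (r < n)%N -> I r.+1 (g r).
Hypothesis powE : forall r, (r < n)%N -> g r = \sum_(j < n) w r j * f j.

Lemma ksub_mono (J J' : A -> Prop) m (x : kos m) :
  (forall a, J a -> J' a) -> ksub J x -> ksub J' x.
Proof.
move=> JJ; elim: m x => [|m IH] x /=; first exact: JJ.
by case=> ? ?; split; exact: IH.
Qed.

Lemma ksub_scale (J J' : A -> Prop) c m (x : kos m) :
  (forall a, J (c * a) -> J' a) -> ksub J (c *: x) -> ksub J' x.
Proof.
move=> JJ; elim: m x => [|m IH] x /=; first exact: JJ.
by case=> ? ?; split; exact: IH.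
Qed.

Lemma ksub_eq0 (J : A -> Prop) m (x : kos m) :
  (forall a, J a -> a = 0) -> ksub J x -> x = 0.
Proof.
move=> J0; elim: m x => [|m IH] x /=; first exact: J0.
by case: x => y z /= [hy hz]; rewrite (IH y hy) (IH z hz).
Qed.

Lemma ksub_quo r m (x : kos m) : (r < n)%N ->
  ksub (I r.+1) x -> ksub (I r) (x - g r *: kmap (phi r) x).
Proof.
move=> rn; elim: m x => [|m IH] x /=; first exact: Iphi.
by case: x => a b /= [ha hb]; split; exact: IH.
Qed.

(** A homotopy for multiplication by g_r, which is a combination of the f_j. *)
Definition khoms r m (x : kos m) : kos m := \sum_(j < n) w r j *: khom j x.

Lemma kdiff_khoms r (x : kos n) : (r < n)%N ->
  kdiff f (khoms r x) + khoms r (kdiff f x) = g r *: x.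
Proof.
move=> rn; have kdiff_sum (s : seq 'I_n) (F : 'I_n -> kos n) :
    kdiff f (\sum_(j <- s) F j) = \sum_(j <- s) kdiff f (F j).
  by apply: (big_morph (@kdiff f n)) => [u v|]; [exact: kdiffD | exact: kdiff0].
rewrite /khoms kdiff_sum -big_split /= powE // scaler_suml.
apply: eq_bigr => j _; rewrite kdiffZ -scalerDr kdiff_khom // scalerA //.
Qed.

(** Depth sensitivity of the Koszul complex: modulo r terms of the regular
    sequence, the homology of f vanishes in degrees above r. Downward induction
    on r, from r = n where there is nothing in those degrees. For a cycle c
    modulo I r, the chain khoms c has boundary g_r c, so it is a cycle modulo I
    (r + 1) one degree higher; by induction it is a boundary plus g_r e for
    some e. Taking boundaries, g_r c is congruent to g_r times the boundary of
    e, and g_r can be cancelled. *)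
Lemma koszul_exact_mod r i (c : kos n) : (r <= n)%N -> (r < i)%N -> kdeg i c ->
  ksub (I r) (kdiff f c) ->
  exists2 b : kos n, kdeg i.+1 b & ksub (I r) (c - kdiff f b).
Proof.
move=> rn; rewrite -(subKn rn); move: (n - r)%N (leq_subr r n) => s {r rn}.
elim: s i c => [|s IH] i c sn; rewrite ?subn0.
  move=> ni ic _; exists 0; first exact: kdeg0.
  by rewrite (kdeg_large ni ic) kdiff0 subr0; exact: ksub0.
set r := (n - s.+1)%N; have rS : (n - s)%N = r.+1 by rewrite /r subnSK.
have rn : (r < n)%N by rewrite -rS leq_subr.
move=> ri ic zc.
have sD J x y : ksub (I J) x -> ksub (I J) y -> ksub (I J) (x + y : kos n).
  by apply: ksubD => *; exact: ID.
have sN J x : ksub (I J) x -> ksub (I J) (- x : kos n).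
  by apply: (ksubN (I0 J)) => *; exact: ID.
have Hc : kdeg i.+1 (khoms r c).
  rewrite /khoms; elim/big_ind: _; [exact: kdeg0 | exact: kdegD |].
  by move=> j _; apply: kdegZ; exact: kdeg_hom.
have Hz J x : ksub (I J) x -> ksub (I J) (khoms r x : kos n).
  move=> hx; rewrite /khoms; elim/big_ind: _ => [|*|j _].
  - exact: ksub0.
  - exact: sD.
  - apply: (ksubZ (I0 J)) => [*|]; first exact: ID.
    by apply: (ksub_hom (I0 J)) => // *; exact: ID.
have dz J x : ksub (I J) x -> ksub (I J) (kdiff f x : kos n).
  by apply: (ksub_diff (I0 J)) => *; exact: ID.
have dHc : kdiff f (khoms r c) = g r *: c - khoms r (kdiff f c).
  by rewrite -(kdiff_khoms _ rn) addrK.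
have [b ib hb] : exists2 b : kos n, kdeg i.+2 b &
    ksub (I r.+1) (khoms r c - kdiff f b).
  rewrite -rS; apply: (IH i.+1 _ (ltnW sn)); rewrite ?rS //.
  rewrite dHc; apply: sD; last first.
    by apply: sN; apply: ksub_mono (Hz _ _ zc) => a; exact: IS.
  elim: (n) c {ic zc Hc dHc Hz} => [|m IHm] x /=; last by split; exact: IHm.
  by have := ID (x : A) (gI rn) (I0 r.+1); rewrite addr0 mulrC.
set x := khoms r c - kdiff f b in hb.
have ix : kdeg i.+1 x.
  by apply: kdegD => //; apply: kdegN; apply: kdeg_diff.
exists (kmap (phi r) x); first exact: kdeg_map.
apply: (ksub_scale (c := g r) (J := I r)) => [a|]; first exact: Ireg.
have -> : g r *: (c - kdiff f (kmap (phi r) x))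
    = khoms r (kdiff f c) + kdiff f (x - g r *: kmap (phi r) x).
  rewrite scalerBr -kdiffZ kdiffB /x kdiffB kdiffK subr0 dHc.
  by rewrite addrA [_ + (g r *: c - _)]addrC subrK.
by apply: sD; [exact: Hz | apply/dz/ksub_quo].
Qed.

End Depth.

(** The elements of degree 0 and 1, as scalars and as vectors. *)
Fixpoint kos0 n (c : A) : kos n :=
  match n return kos n with 0 => c | n'.+1 => (kos0 n' c, 0) : kos n'.+1 end.

Fixpoint kos1 n (v : nat -> A) : kos n :=
  match n return kos n with
  | 0 => 0 | n'.+1 => (kos1 n' v, kos0 n' (v n')) : kos n'.+1 end.

Lemma kos0Z n a c : kos0 n (a * c) = a *: kos0 n c.
Proof. by elim: n => [//|n IH] /=; rewrite IH; congr (_, _); rewrite scaler0. Qed.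
Lemma kos0D n a c : kos0 n (a + c) = kos0 n a + kos0 n c.
Proof. by elim: n => [//|n IH] /=; rewrite IH; congr (_, _); rewrite /= addr0. Qed.
Lemma kos0N n c : kos0 n (- c) = - kos0 n c.
Proof. by rewrite -mulN1r kos0Z scaleN1r. Qed.
Lemma kos0_0 n : kos0 n 0 = 0.
Proof. by rewrite -(mul0r 0) kos0Z scale0r. Qed.
Lemma kos0_inj n : injective (kos0 n).
Proof. by elim: n => [//|n IH] a b /= [] /IH. Qed.

Lemma kdeg_kos0 n c : kdeg 0 (kos0 n c).
Proof. by elim: n => [//|n IH] /=. Qed.
Lemma kdeg_kos1 n v : kdeg 1 (kos1 n v).
Proof. by elim: n => [//|n IH] /=; split=> //; exact: kdeg_kos0. Qed.

Lemma kdeg0P n (x : kos n) : kdeg 0 x -> exists c, x = kos0 n c.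
Proof.
elim: n x => [|n IH] x; first by exists x.
by case: x => a b /= [/IH [c ->] ->]; exists c.
Qed.

Lemma eq_kos1 n v v' : (forall i, (i < n)%N -> v i = v' i) -> kos1 n v = kos1 n v'.
Proof.
elim: n => [//|n IH] h /=; rewrite h // IH // => i /ltnW; exact: h.
Qed.

Lemma kdeg1P n (x : kos n) : kdeg 1 x -> exists v, x = kos1 n v.
Proof.
elim: n x => [|n IH] x; first by move=> /= ->; [exists (fun=> 0)|].
case: x => a b /= [/IH [v ->] /kdeg0P [c ->]].
exists (fun i => if (i < n)%N then v i else c); rewrite ltnn; congr (_, _).
by apply: eq_kos1 => i ->.
Qed.

Lemma kos1_inj n v v' : kos1 n v = kos1 n v' -> forall i, (i < n)%N -> v i = v' i.
Proof.
elim: n => [//|n IH] /= [] /IH h /kos0_inj e i.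
by rewrite ltnS leq_eqVlt => /orP[/eqP ->|/h].
Qed.

Lemma kos1D n v v' : kos1 n v + kos1 n v' = kos1 n (fun i => v i + v' i).
Proof.
elim: n => [|n IH] /=; first by rewrite addr0.
by rewrite -IH kos0D.
Qed.
Lemma kos1Z n c v : c *: kos1 n v = kos1 n (fun i => c * v i).
Proof.
elim: n => [|n IH] /=; first by rewrite scaler0.
by rewrite -IH kos0Z.
Qed.

Lemma kdiff_kos1 f n v : kdiff f (kos1 n v) = kos0 n (\sum_(i < n) v i * f i).
Proof.
elim: n => [|n IH] /=; first by rewrite big_ord0.
rewrite IH (kdeg0_diff _ (kdeg_kos0 _ _)) oppr0 big_ord_recr /=.
by rewrite kos0D [v n * _]mulrC kos0Z.
Qed.

(** The boundaries of degree 1 are the trivial relations between the f_i. *)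
Lemma kdiff_deg2 f n (x : kos n) : kdeg 2 x ->
  exists b : nat -> nat -> A, kdiff f x =
    kos1 n (fun j => \sum_(i < n | (i < j)%N) b i j * f i
                     - \sum_(i < n | (j < i)%N) b j i * f i).
Proof.
elim: n x => [|n IH] x; first by exists (fun _ _ => 0).
case: x => a y /= [/IH [b ->] /kdeg1P [v ->]].
exists (fun i j => if j == n then - v i else b i j).
rewrite kdiff_kos1 kos1Z kos1D -kos0N; congr (_, _).
  apply: eq_kos1 => j jn; rewrite [X in _ = X - _]big_mkcond [X in _ = _ - X]big_mkcond.
  rewrite !big_ord_recr /= -!big_mkcond jn (ltn_eqF jn) eqxx ltnNge ltnW //= addr0.
  rewrite opprD mulNr opprK addrA [f n * _]mulrC; congr (_ - _ + _).
  by apply: eq_bigr => i _; rewrite (ltn_eqF (ltn_ord i)).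
congr kos0; rewrite eqxx [X in _ = X - _]big_mkcond [X in _ = X - _]big_ord_recr /= ltnn addr0.
rewrite [X in _ - X]big1 ?subr0.
  by rewrite -sumrN; apply: eq_bigr => i _; rewrite ltn_ord mulNr.
by move=> i; rewrite ltnNge -ltnS ltn_ord.
Qed.

End Koszul.

(** * Uncountability of the complex numbers *)

Section Uncountable.
Context (R : realType).

(** One of the two halves of the interval, shrunk if necessary, avoids the next
    point. *)
Lemma avoid_interval (s : seq R) (a b : R) : a < b ->
  exists a' b', [/\ a <= a', a' < b', b' <= b & forall x, x \in s -> ~~ (a' <= x <= b')].
Proof.
elim: s a b => [|x s IH] a b ab; first by exists a, b.
have [a1 [b1 [aa1 ab1 bb1 h]]] := IH a b ab.
have [xm|mx] := lerP x ((a1 + b1) / 2).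
  exists ((a1 + 3 * b1) / 4), b1; split=> [|||y]; [lra|lra|lra|].
  rewrite inE => /orP[/eqP ->|/h]; first by rewrite negb_and -!ltNge; apply/orP; left; lra.
  by apply: contra => /andP[y1 ->]; rewrite andbT; lra.
exists a1, ((a1 + b1) / 2); split=> [|||y]; [lra|lra|lra|].
rewrite inE => /orP[/eqP ->|/h]; first by rewrite negb_and -!ltNge mx orbT.
by apply: contra => /andP[-> y1] /=; lra.
Qed.

(** Cantor's nested intervals, the k-th one avoiding the finite set F k. *)
Lemma real_uncountable (F : nat -> seq R) : exists x, forall k, x \notin F k.
Proof.
have /choice [nxt nxtP] (kab : nat * (R * R)) : exists ab' : R * R,
    kab.2.1 < kab.2.2 -> [/\ kab.2.1 <= ab'.1, ab'.1 < ab'.2, ab'.2 <= kab.2.2 &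
    forall x, x \in F kab.1 -> ~~ (ab'.1 <= x <= ab'.2)].
  case: kab => k [a b] /=; case: (ltP a b) => ab; last by exists (0, 0).
  by have [a' [b' h]] := avoid_interval (F k) ab; exists (a', b').
pose u := fix u k := if k is k'.+1 then nxt (k', u k') else (0, 1).
have ult k : (u k).1 < (u k).2.
  by elim: k => [|k IH] /=; [exact: ltr01 | have [] := nxtP (k, u k) IH].
have ustep k := nxtP (k, u k) (ult k).
have umon j k : (u k).1 <= (u (j + k)%N).1 /\ (u (j + k)%N).2 <= (u k).2.
  elim: j => [//|j [IH1 IH2]]; have [h1 _ h2 _] := ustep (j + k)%N.
  by split; [apply: le_trans IH1 h1 | apply: le_trans h2 IH2].
have uab j k : (u j).1 <= (u k).2.
  have [h _] := umon k j; have [_ h'] := umon j k; rewrite addnC in h'.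
  by apply: le_trans h (le_trans (ltW (ult _)) h').
pose A := [set y | exists k, y = (u k).1]%classic.
have supA : has_sup A.
  split; first by exists (u 0%N).1, 0%N.
  by exists (u 0%N).2 => _ [k ->]; exact: uab.
exists (sup A) => k; have [_ _ _ h] := ustep k; apply/negP => /h /negP; apply.
apply/andP; split.
  by apply: (sup_upper_bound supA); exists k.+1.
by apply: sup_le_ub => [|_ [j ->]]; [exists (u 0%N).1, 0%N | exact: (uab j k.+1)].
Qed.

End Uncountable.

(** Uncountability in the form in which it is used: every map to nat has an
    infinite fiber, the latter being expressed by finite subsets of every size.
    *)
Definition uncountable_type (T : eqType) := forall g : T -> nat,
  exists k, forall s, exists t : seq T, [/\ uniq t, size t = s & forall x, x \in t -> g x = k].

Lemma uncountable_real (R : realType) : uncountable_type R.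
Proof.
move=> g; apply: contrapT => nk.
have /choice [F FP] k : exists F : seq R, forall x, g x = k -> x \in F.
  (* a finite fiber has a finite list F k that contains it *)
  have : ~ forall s, exists t : seq R, [/\ uniq t, size t = s & forall x, x \in t -> g x = k].
    by move=> h; apply: nk; exists k.
  move/existsNP => [s sP].
  suff [F [_ _ h]] : exists F : seq R, [/\ uniq F, (size F <= s)%N & forall x, g x = k -> x \in F].
    by exists F.
  apply: contrapT => nF.
  have /(_ s (leqnn s)) [t [ut st tk]] m : (m <= s)%N ->
      exists t : seq R, [/\ uniq t, size t = m & forall x, x \in t -> g x = k].
    elim: m => [_|m IH ms]; first by exists [::].
    have [t [ut st tk]] := IH (ltnW ms).
    have [x [gx xt]] : exists x, g x = k /\ x \notin t.
      apply: contrapT => nx; apply: nF; exists t; split=> //; first by rewrite st ltnW.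
      by move=> x gx; apply/negPn/negP => xt; apply: nx; exists x.
    exists (x :: t); split; rewrite /= ?xt ?st // => y.
    by rewrite inE => /orP[/eqP ->|/tk].
  by apply: sP; exists t.
by have [x /(_ (g x))] := real_uncountable F; rewrite (FP _ x).
Qed.

Lemma uncountable_inj (T U : eqType) (h : T -> U) :
  injective h -> uncountable_type T -> uncountable_type U.
Proof.
move=> hinj uT g; have [k kP] := uT (g \o h); exists k => s.
have [t [ut st tk]] := kP s; exists (map h t); split.
- by rewrite map_inj_uniq.
- by rewrite size_map.
- by move=> _ /mapP[x xt ->]; exact: tk.
Qed.

Lemma uncountable_complex (R : realType) : uncountable_type R[i].
Proof.
apply: (uncountable_inj (h := fun x : R => x%:C%C)) (@uncountable_real R).
by move=> x y [].
Qed.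

(** * A Nullstellensatz over uncountable fields *)

Section Nullstellensatz.
Context (K : closedFieldType) (uncK : uncountable_type K) (n : nat).
Local Notation P := {mpoly K[n]}.

Definition poly_ideal (I : P -> Prop) := I 0 /\ forall a p q, I p -> I q -> I (a * p + q).

Lemma poly_idealM I a p : poly_ideal I -> I p -> I (a * p).
Proof. by case=> I0 ID Ip; rewrite -[_ * _]addr0; exact: ID. Qed.
Lemma poly_idealD I p q : poly_ideal I -> I p -> I q -> I (p + q).
Proof. by case=> I0 ID Ip Iq; rewrite -[p]mul1r; exact: ID. Qed.
Lemma poly_idealN I p : poly_ideal I -> I p -> I (- p).
Proof. by move=> iI Ip; rewrite -mulN1r; exact: poly_idealM. Qed.

Lemma mpoly_dependent D s (b : 'I_s -> P) : (forall i, (msize (b i) <= D)%N) ->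
  (#|{: 'X_{1..n < D}}| < s)%N ->
  exists2 l : 'I_s -> K, \sum_i l i *: b i = 0 & exists i, l i != 0.
Proof.
move=> bD sD; pose T := 'X_{1..n < D} : finType.
pose M : 'M[K]_(s, #|T|) := \matrix_(i, j) (b i)@_(enum_val j : 'X_{1..n < D}).
have : ~~ row_free M.
  by rewrite /row_free neq_ltn (leq_ltn_trans (rank_leq_col M)).
rewrite -kermx_eq0 => /rowV0Pn [u /sub_kermxP uM u0].
exists (fun i => u 0 i); last first.
  by move/eqP/rowP: u0 => /existsNP [i ui]; exists i; apply/eqP; rewrite mxE in ui.
apply/mpolyP => m; rewrite mcoeff0 linear_sum /=.
have [mD|Dm] := ltnP (mdeg m) D; last first.
  rewrite big1 // => i _; rewrite mcoeffZ memN_msupp_eq0 ?mulr0 //.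
  by apply: msize_mdeg_ge; apply: leq_trans Dm.
have := congr1 (fun v : 'rV_#|T| => v 0 (enum_rank (BMultinom mD : T))) uM.
rewrite !mxE => uMm; rewrite -[RHS]uMm; apply: eq_bigr => i _.
by rewrite mcoeffZ mxE enum_rankK.
Qed.

Definition peval (x : P) (q : {poly K}) : P := (map_poly (@mpolyC n K) q).[x].

Lemma pevalM x p q : peval x (p * q) = peval x p * peval x q.
Proof. by rewrite /peval rmorphM hornerM. Qed.
Lemma pevalXsubC x c : peval x ('X - c%:P) = x - c%:MP.
Proof. by rewrite /peval rmorphB /= map_polyX map_polyC hornerD hornerN hornerX hornerC. Qed.
Lemma pevalZ x c q : peval x (c *: q) = c%:MP * peval x q.
Proof. by rewrite /peval map_polyZ hornerZ. Qed.
Lemma peval1 x : peval x 1 = 1.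
Proof. by rewrite /peval rmorph1 hornerC. Qed.
Lemma peval_prod x (I : Type) (s : seq I) (A : pred I) (F : I -> {poly K}) :
  peval x (\prod_(i <- s | A i) F i) = \prod_(i <- s | A i) peval x (F i).
Proof. exact: (big_morph (peval x) (pevalM x) (peval1 x)). Qed.
Lemma peval_sum x (I : Type) (s : seq I) (A : pred I) (F : I -> {poly K}) :
  peval x (\sum_(i <- s | A i) F i) = \sum_(i <- s | A i) peval x (F i).
Proof. by rewrite /peval rmorph_sum horner_sum. Qed.

(** Suppose that every c fails, through a relation h^N = b (x - c) modulo I. By
    uncountability there are arbitrarily many c with the same N and the same
    bound on the size of b, hence enough to make the b linearly dependent.
    Clearing denominators in the dependence gives h^N q(x) in I with q a
    nonzero polynomial in one variable. It splits, and each factor x - c can be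
    traded for another power of h, so a power of h is in I. *)
Lemma ideal_avoids_step (I : P -> Prop) (h x : P) : poly_ideal I -> (forall N, ~ I (h ^+ N)) ->
  exists c : K, forall N, ~ exists b, I (h ^+ N - b * (x - c%:MP)).
Proof.
move=> iI nh; apply: contrapT => nc.
have /choice [Nb NbP] (c : K) : exists Nb : nat * P, I (h ^+ Nb.1 - Nb.2 * (x - c%:MP)).
  apply: contrapT => ncc; apply: nc; exists c => N [b hb]; apply: ncc.
  by exists (N, b).
have [k kP] := uncK (fun c => pickle ((Nb c).1, msize (Nb c).2)).
have [t1 [_ s1 h0]] := kP 1%N; case: t1 s1 h0 => [|c0 []] //= _ h0.
set N := (Nb c0).1; set D := msize (Nb c0).2.
have kE : k = pickle (N, D) by rewrite -(h0 c0) // inE.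
have [t [ut st tk]] := kP #|{: 'X_{1..n < D}}|.+1.
pose s := #|{: 'X_{1..n < D}}|.+1.
pose c (i : 'I_s) := nth 0 t i.
have cinj : injective c.
  by move=> i j /eqP; rewrite nth_uniq ?st // => /eqP /val_inj.
have cP i : (Nb (c i)).1 = N /\ msize (Nb (c i)).2 = D.
  have := tk (c i); rewrite mem_nth ?st // kE => /(_ isT).
  by move/(pcan_inj pickleK) => [-> ->].
pose b i := (Nb (c i)).2.
have bP i : I (h ^+ N - b i * (x - (c i)%:MP)) by have := NbP (c i); rewrite (cP i).1.
have [l l0 [i0 li0]] : exists2 l : 'I_s -> K, \sum_i l i *: b i = 0 & exists i, l i != 0.
  by apply: (@mpoly_dependent D) => // i; rewrite (cP i).2.
(* the numerator of the sum of the l_i / (X - c_i) *)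
pose q : {poly K} := \sum_i l i *: \prod_(j | j != i) ('X - (c j)%:P).
have q0 : q != 0.
  apply/eqP => /(congr1 (horner^~ (c i0))); rewrite horner0 horner_sum.
  rewrite (bigD1 i0) //= [X in _ + X]big1 => [|i ii0].
    rewrite addr0 hornerZ horner_prod => /eqP; rewrite mulf_eq0 (negbTE li0) /=.
    rewrite prodf_seq_eq0 => /hasP [j _] /andP[ji].
    by rewrite hornerXsubC subr_eq0 => /eqP /cinj e; rewrite e eqxx in ji.
  rewrite hornerZ horner_prod (bigD1 i0) /=; last by rewrite eq_sym.
  by rewrite hornerXsubC subrr mul0r mulr0.
have hq : I (h ^+ N * peval x q).
  pose r i := \prod_(j < s | j != i) (x - (c j)%:MP).
  have -> : h ^+ N * peval x q
      = \sum_i ((l i)%:MP * r i) * (h ^+ N - b i * (x - (c i)%:MP)).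
    have -> : \sum_i ((l i)%:MP * r i) * (h ^+ N - b i * (x - (c i)%:MP))
        = \sum_i (l i)%:MP * r i * h ^+ N
          - \sum_i (l i *: b i) * \prod_j (x - (c j)%:MP).
      rewrite -sumrB; apply: eq_bigr => i _.
      rewrite [\prod_j _](bigD1 i) //= -/(r i) -mul_mpolyC; ring.
    rewrite -(mulr_suml _ _ (fun i => l i *: b i)) l0 mul0r subr0 mulrC -mulr_suml.
    congr (_ * _).
    rewrite peval_sum; apply: eq_bigr => i _; rewrite pevalZ peval_prod.
    by congr (_ * _); apply: eq_bigr => j _; rewrite pevalXsubC.
  by elim/big_ind: _ => [||i _]; [exact: iI.1 | move=> *; exact: poly_idealD | exact: poly_idealM].
have [rs qE] := closed_field_poly_normal q.
have lc0 : lead_coef q != 0 by rewrite lead_coef_eq0.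
move: (lead_coef q) lc0 qE => lc lc0 qE.
have {}hq : I (h ^+ N * \prod_(z <- rs) (x - z%:MP)).
  have := poly_idealM (lc^-1)%:MP iI hq.
  rewrite qE pevalZ mulrCA [_%:MP * (_ * _)]mulrA -mpolyCM mulVf // mul1r peval_prod.
  by under eq_bigr do rewrite pevalXsubC.
(* trade the roots of q one by one for powers of h *)
elim: rs N {h0 t ut st tk s c cinj cP b bP l l0 i0 li0 q q0 qE D kE lc lc0} hq => [|z rs IH] N.
  by rewrite big_nil mulr1; exact: nh.
rewrite big_cons => hz; have hb := NbP z; move: (Nb z) hb => [M b] /= hb.
apply: (IH (N + M)%N); set p := \prod_(_ <- _) _ in hz *.
have -> : h ^+ (N + M) * p = (h ^+ N * p) * (h ^+ M - b * (x - z%:MP))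
    + b * (h ^+ N * ((x - z%:MP) * p)) by rewrite exprD; ring.
by apply: poly_idealD => //; apply: poly_idealM.
Qed.

(** After one equation x_i = a_i for each variable the enlarged ideal J still
    contains no power of h. Every polynomial is congruent to its value at a
    modulo J, so the values of elements of J vanish and that of h does not. *)
Lemma nullstellensatz (I : P -> Prop) (h : P) : poly_ideal I -> (forall N, ~ I (h ^+ N)) ->
  exists a : 'I_n -> K, (forall p, I p -> p.@[a] = 0) /\ h.@[a] != 0.
Proof.
move=> iI nh.
have /(_ n (leqnn n)) : forall r, (r <= n)%N -> exists a : 'I_n -> K, exists J : P -> Prop,
    [/\ poly_ideal J, forall p, I p -> J p, forall N, ~ J (h ^+ N) &
        forall i : 'I_n, (i < r)%N -> J ('X_i - (a i)%:MP)].
  elim=> [|r IH] rn.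
    by exists (fun=> 0), I; split.
  have [a [J [iJ IJ nJ aJ]]] := IH (ltnW rn).
  pose i := Ordinal rn; have [c cP] := ideal_avoids_step 'X_i iJ nJ.
  exists (fun j => if j == i then c else a j), (fun p => exists b, J (p - b * ('X_i - c%:MP))).
  split=> [|p /IJ Jp||j].
  - split=> [|u p q [b hb] [b' hb']].
      by exists 0; rewrite mul0r subr0; exact: iJ.1.
    exists (u * b + b'); have := iJ.2 u _ _ hb hb'.
    by congr (J _); ring.
  - by exists 0; rewrite mul0r subr0.
  - exact: cP.
  - rewrite ltnS leq_eqVlt => /orP[/eqP ji|jr].
      have -> : j = i by exact: val_inj.
      by exists 1; rewrite eqxx mul1r subrr; exact: iJ.1.
    exists 0; rewrite mul0r subr0 ifN; first exact: aJ.
    by rewrite -val_eqE /= ltn_eqF.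
case=> a [J [iJ IJ nJ aJ]]; exists a.
have Jev p : J (p - p.@[a]%:MP).
  elim/mpolyind: p => [|c m p _ _ hp].
    by rewrite meval0 subr0; exact: iJ.1.
  rewrite mevalD mpolyCD opprD addrACA; apply: poly_idealD => //.
  rewrite mevalZ mpolyCM -mul_mpolyC -mulrBr; apply: poly_idealM => //.
  rewrite mevalX mpolyXE_id.
  apply: (big_rec2 (fun v u => J (u - v%:MP))) => [|i v u _ huv].
    by rewrite subrr; exact: iJ.1.
  have -> : 'X_i ^+ m i * u - (a i ^+ m i * v)%:MP = 'X_i ^+ m i * (u - v%:MP)
      + v%:MP * ('X_i ^+ m i - (a i)%:MP ^+ m i) by rewrite mpolyCM rmorphXn /=; ring.
  apply: poly_idealD => //; apply: poly_idealM => //; rewrite subrXX mulrC.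
  by apply: poly_idealM => //; exact: aJ.
split=> [p /IJ Jp|].
  apply/eqP/negPn/negP => pa; apply: (nJ 0%N); rewrite expr0.
  have := poly_idealD iJ Jp (poly_idealN iJ (Jev p)); rewrite opprB addrC subrK => Jc.
  by have := poly_idealM (p.@[a])^-1%:MP iJ Jc; rewrite -mpolyCM mulVf.
apply/eqP => ha; apply: (nJ 1%N); rewrite expr1.
by have := Jev h; rewrite ha subr0.
Qed.

End Nullstellensatz.

(** * Weighted homogeneous polynomials *)

Section Weights.
Context (n : nat).

(** Clear the denominators of the weights. *)
Lemma int_weights (w : 'I_n -> rat) : (forall j, 0 < w j) ->
  exists (q : nat) (u : 'I_n -> nat), forall j, (0 < u j)%N /\ (u j)%:R = q%:R * w j.
Proof.
move=> w0; exists (\prod_j `|denq (w j)|)%N.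
exists (fun j => `|numq (w j)| * \prod_(i | i != j) `|denq (w i)|)%N => j; split.
  rewrite muln_gt0 absz_gt0 numq_eq0 gt_eqF ?w0 //= prodn_cond_gt0 // => i _.
  by rewrite absz_gt0 denq_neq0.
rewrite [X in _ = X%:R * _](bigD1 j) //= !natrM mulrAC; congr (_ * _).
by rewrite !natr_absz !gtr0_norm ?numq_gt0 ?denq_gt0 // numqE mulrC.
Qed.

Context (K : numFieldType).
Implicit Types (f : {mpoly K[n]}).

Lemma weighted_homogeneous_nat f : weighted_homogeneous f ->
  exists (u : 'I_n -> nat) (V : nat),
    (forall j, (0 < u j)%N) /\ forall m, m \in msupp f -> (\sum_j m j * u j = V)%N.
Proof.
case=> w [W [w0 wW]]; have [q [u uP]] := int_weights w0.
exists u, (\sum_j mlead f j * u j)%N; split=> [j|m mf]; first exact: (uP j).1.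
have sumE (v : 'X_{1..n}) : v \in msupp f -> (\sum_j v j * u j)%N%:R = q%:R * W.
  move=> /wW <-; rewrite natr_sum mulr_sumr; apply: eq_bigr => j _.
  by rewrite natrM (uP j).2 mulrCA.
apply/eqP; rewrite -(eqr_nat rat) !sumE // mlead_supp //.
by apply: contraTneq mf => ->; rewrite msupp0.
Qed.

Section Homogeneous.
Context (f : {mpoly K[n]}) (u : 'I_n -> nat) (V : nat).
Hypothesis fV : forall m, m \in msupp f -> (\sum_j m j * u j = V)%N.

Lemma euler_identity : \sum_j (u j)%:R *: ('X_j * f^`M(j)) = V%:R *: f.
Proof.
have eulerX (m : 'X_{1..n}) j : 'X_j * ('X_[m] : {mpoly K[n]})^`M(j) = (m j)%:R *: 'X_[m].
  rewrite mderivX !scaler_nat.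
  have [->|mj] := posnP (m j); first by rewrite !mulr0n mulr0.
  by rewrite mulrnAr -mpolyXD addmC submK // lep1mP -lt0n.
have fE j : 'X_j * f^`M(j) = \sum_(m <- msupp f) f@_m *: ((m j)%:R *: 'X_[m]).
  rewrite {1}[f]mpolyE linear_sum mulr_sumr; apply: eq_bigr => m _.
  by rewrite linearZ /= -scalerAr eulerX.
under eq_bigr do rewrite fE scaler_sumr.
rewrite exchange_big [f in RHS]mpolyE scaler_sumr !big_seq; apply: eq_bigr => m mf /=.
under eq_bigr do rewrite !scalerA.
rewrite -scaler_suml scalerA; congr (_ *: _).
rewrite -(fV mf) natr_sum mulr_suml; apply: eq_bigr => j _.
by rewrite natrM; ring.
Qed.

(** The weighted dilation of ratio t multiplies the monomials of f by t^V, and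
    those of f_i by t^(V - u_i). *)
Lemma meval_dilate i (t : K) (x : 'I_n -> K) :
  (f^`M(i)).@[fun j => t ^+ u j * x j] * t ^+ u i = t ^+ V * (f^`M(i)).@[x].
Proof.
rewrite !mevalE mulr_suml mulr_sumr !big_seq; apply: eq_bigr => m mf.
have <- : (\sum_j m j * u j + u i = V)%N.
  rewrite -(fV (m := (m + U_(i))%MM)).
    rewrite (bigD1 i) //= [RHS](bigD1 i) //= mnmDE mnm1E eqxx mulnDl mul1n addnAC.
    congr (_ + _)%N; apply: eq_bigr => j ji.
    by rewrite mnmDE mnm1E eq_sym (negbTE ji) addn0.
  move: mf; rewrite !mcoeff_msupp mcoeff_deriv; apply: contraNneq => ->.
  by rewrite mul0rn.
have -> : \prod_j (t ^+ u j * x j) ^+ m j = t ^+ (\sum_j m j * u j) * \prod_j x j ^+ m j.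
  rewrite expr_sum -big_split; apply: eq_bigr => j _.
  by rewrite exprMn -exprM mulnC.
by rewrite exprD; ring.
Qed.

(** Dilating a zero of the gradient with a small ratio moves it into the
    neighbourhood where the origin is the only singular point. It is a point of
    V(f) by Euler's identity, in which V is invertible because f(0) = 0 and f
    is not zero. *)
Lemma isolated_zero : (0 < n)%N -> (forall j, (0 < u j)%N) -> isolated_singularity f ->
  (0 < V)%N /\ forall x : 'I_n -> K, (forall i, (f^`M(i)).@[x] = 0) -> forall i, x i = 0.
Proof.
move=> n0 u0 [[f0 _] [e e0 iso]].
have fn0 : f != 0.
  apply/eqP => fe; have := iso (fun=> e / 2) _ _ (Ordinal n0).
  rewrite ger0_norm ?divr_ge0 ?ltW // => /(_ (fun=> _)) h.
  have /eqP : e / 2 = 0.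
    apply: h; first by rewrite ltr_pdivrMr // ltr_pMr // ltr1n.
    by split=> [|i]; rewrite fe ?raddf0 ?meval0.
  by rewrite mulf_eq0 invr_eq0 (gt_eqF e0) pnatr_eq0.
have V0 : (0 < V)%N.
  have mf := mlead_supp fn0; rewrite -(fV mf).
  case: (posnP (\sum_j mlead f j * u j)) => // V0.
  (* if V = 0, positivity of the weights makes f constant *)
  have f1 : f = (f@_0%MM)%:MP.
    apply/mpolyP => m; rewrite mcoeffC; have [<-|m0] := eqVneq m 0%MM; first by rewrite mulr1.
    rewrite mulr0; apply: memN_msupp_eq0; apply: contra m0 => mf'.
    have := fV mf'; rewrite -(fV mf) V0 => /eqP; rewrite sum_nat_eq0 => /forallP z.
    by apply/eqP/mnmP => j; have := z j; rewrite muln_eq0 (gtn_eqF (u0 j)) orbF mnm0E => /eqP.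
  by move: f0 fn0; rewrite f1 mevalC => ->; rewrite eqxx.
split=> // x xz.
(* a ratio t <= 1 with t |x_j| < e for all j *)
pose t := e / (e + 1 + \sum_j `|x j|).
have d0 : 0 < e + 1 + \sum_j `|x j|.
  by apply: ltr_wpDr; [exact: sumr_ge0 | exact: addr_gt0].
have t0 : 0 < t by exact: divr_gt0.
have t1 : t <= 1.
  rewrite ler_pdivrMr // mul1r -addrA lerDl addr_ge0 //; exact: sumr_ge0.
have yz i : (f^`M(i)).@[fun j => t ^+ u j * x j] = 0.
  have /eqP := meval_dilate i t x; rewrite xz mulr0 mulf_eq0 expf_eq0 (gt_eqF t0) andbF orbF.
  by move/eqP.
have yf : f.@[fun j => t ^+ u j * x j] = 0.
  have := congr1 (meval (fun j => t ^+ u j * x j)) euler_identity.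
  rewrite raddf_sum big1 => [/esym/eqP|j _]; last first.
    by rewrite /= mevalZ mevalM yz !mulr0.
  by rewrite mevalZ mulf_eq0 pnatr_eq0 gtn_eqF //= => /eqP.
move=> i; have small j : `|t ^+ u j * x j| < e.
  rewrite normrM normrX (gtr0_norm t0).
  apply: (@le_lt_trans _ _ (t * `|x j|)).
    rewrite ler_wpM2r // -[leRHS]expr1; apply: ler_wiXn2l => //; exact: ltW.
  rewrite mulrAC ltr_pdivrMr // ltr_pM2l //.
  apply: (@le_lt_trans _ _ (\sum_j `|x j|)).
    by rewrite (bigD1 j) //= lerDl sumr_ge0.
  by rewrite ltrDr addr_gt0.
have /eqP := iso _ small (conj yf yz) i.
by rewrite mulf_eq0 expf_eq0 (gt_eqF t0) andbF => /eqP.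
Qed.

End Homogeneous.
End Weights.

(** * The Jacobian ideal and its syzygies *)

Lemma sum_ltpair (V : nmodType) (n : nat) (G : 'I_n -> 'I_n -> V) :
  \sum_(p : ltpair n) G (val p).1 (val p).2 = \sum_(i < n) \sum_(j < n | (i < j)%N) G i j.
Proof.
rewrite pair_big_dep /=; symmetry.
exact: (big_sub [pred p : 'I_n * 'I_n | (p.1 < p.2)%N] (fun p => G p.1 p.2)).
Qed.

Definition pder (K : fieldType) (n : nat) (f : {mpoly K[n]}) (i : 'I_n) :
    {mpseries K[n]} := mpseries_of f^`M(i).

(** The j-th entry of f_(p.1) v_(p.2) - f_(p.2) v_(p.1). Locked, so that
    simplification does not distribute coefficients over the difference. *)
HB.lock Definition trivial_syz (K : fieldType) (n : nat) (f : {mpoly K[n]})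
    (p : ltpair n) (j : 'I_n) : {mpseries K[n]} :=
  pder f (val p).1 *+ ((val p).2 == j) - pder f (val p).2 *+ ((val p).1 == j).

Section Jacobian.
Context (K : fieldType) (n : nat) (f : {mpoly K[n]}).
Local Notation O := {mpseries K[n]}.
Local Notation V1 := {ffun 'I_n -> O}.
Local Notation V2 := {ffun ltpair n -> O}.

Local Notation pder := (pder f).
Local Notation trivial_syz := (trivial_syz f).

Definition jac_comb (a : V1) : O := \sum_i a i * pder i.

Definition trivial_comb (b : V2) : V1 := [ffun j => \sum_p b p * trivial_syz p j].

Fact jac_comb_is_linear : linear jac_comb.
Proof.
move=> c a b; rewrite /jac_comb scaler_sumr -big_split; apply: eq_bigr => i _.
by rewrite !ffunE mulrDl scalerAl.
Qed.
HB.instance Definition _ := GRing.isLinear.Build K V1 O *:%R jac_comb jac_comb_is_linear.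

Fact trivial_comb_is_linear : linear trivial_comb.
Proof.
move=> c a b; apply/ffunP => j; rewrite !ffunE scaler_sumr -big_split; apply: eq_bigr => i _.
by rewrite !ffunE mulrDl scalerAl.
Qed.
HB.instance Definition _ := GRing.isLinear.Build K V2 V1 *:%R trivial_comb trivial_comb_is_linear.

Lemma jac_comb_trivial b : jac_comb (trivial_comb b) = 0.
Proof.
rewrite /jac_comb; under eq_bigr do rewrite ffunE mulr_suml.
rewrite exchange_big big1 //= => p _; rewrite trivial_syz.unlock.
have e (i : 'I_n) (x : O) : \sum_j b p * (x *+ (i == j)) * pder j = b p * x * pder i.
  rewrite (bigD1 i) //= eqxx mulr1n big1 ?addr0 // => j /negbTE ji.
  by rewrite eq_sym ji mulr0n mulr0 mul0r.
under eq_bigr do rewrite mulrBr mulrBl.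
by rewrite sumrB !e; ring.
Qed.

Lemma trivial_comb_pairs (b : 'I_n -> 'I_n -> O) (j : 'I_n) :
  trivial_comb [ffun p => b (val p).1 (val p).2] j
  = \sum_(i < n | (i < j)%N) b i j * pder i - \sum_(i < n | (j < i)%N) b j i * pder i.
Proof.
rewrite ffunE; under eq_bigr do rewrite ffunE trivial_syz.unlock mulrBr.
rewrite sumrB; congr (_ - _).
  rewrite (sum_ltpair (fun i k => b i k * (pder i *+ (k == j)))) [RHS]big_mkcond.
  apply: eq_bigr => i _; case: ifP => ij.
    rewrite (bigD1 j) //= eqxx mulr1n big1 ?addr0 // => k /andP[_ /negbTE ->].
    by rewrite mulr0n mulr0.
  rewrite big1 // => k ik; case: eqP => [e|_]; first by rewrite -e ik in ij.
  by rewrite mulr0n mulr0.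
rewrite (sum_ltpair (fun i k => b i k * (pder k *+ (i == j)))) (bigD1 j) //=.
rewrite [X in _ + X]big1 ?addr0.
  by apply: eq_bigr => i _; rewrite eqxx mulr1n.
by move=> i /negbTE ij; rewrite big1 // => k _; rewrite ij mulr0n mulr0.
Qed.

Lemma jacobianP p : jacobian_ideal f p <-> exists a : V1, p = jac_comb a.
Proof.
split; last first.
  by case=> a ->; apply: ideal_gen_sum => i; exists i.
move: p; apply: ideal_gen_closed.
- split=> [|c p q [a ->] [b ->]]; first by exists 0; rewrite linear0.
  by exists (c *: a + b); rewrite linearP.
- move=> c p [a ->]; exists [ffun i => c * a i]; rewrite /jac_comb mulr_sumr.
  by apply: eq_bigr => i _; rewrite ffunE mulrA.
- move=> p [i ->]; exists [ffun j => (j == i)%:R]; rewrite /jac_comb (bigD1 i) //=.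
  by rewrite ffunE eqxx mul1r big1 ?addr0 // => j /negbTE ji; rewrite ffunE ji mul0r.
Qed.

Definition ordge_vec k (a : V1) := forall i, ordge k (a i).

Lemma subspace_ordge_vec k : subspace (ordge_vec k).
Proof.
split=> [i|c a b ha hb i]; first by rewrite ffunE; exact: ordge0.
by rewrite !ffunE; apply: (subspace_ordge _ _ _).2.
Qed.

(** Gathering coefficients turns the ideal m^k J into the image of m^k O^n
    under [jac_comb]. *)
Lemma milnorP k p : milnor_ideal f k p <-> exists2 a : V1, ordge_vec k a & p = jac_comb a.
Proof.
split; last first.
  case=> a ka ->; rewrite /jac_comb.
  have -> : \sum_i a i * pder i = \sum_i 1 * (a i * pder i).
    by apply: eq_bigr => i _; rewrite mul1r.
  apply: ideal_gen_sum => i; exists (a i), (pder i); split=> //.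
    exact/ideal_exp_maxP.
  by apply/jacobianP; exists [ffun j => (j == i)%:R]; rewrite /jac_comb (bigD1 i) //=
    ffunE eqxx mul1r big1 ?addr0 // => j /negbTE ji; rewrite ffunE ji mul0r.
move: p; apply: ideal_gen_closed.
- split=> [|c p q [a ka ->] [b kb ->]].
    by exists 0; rewrite ?linear0 //; apply: subspace0 (subspace_ordge_vec k).
  by exists (c *: a + b); rewrite ?linearP //; apply: (subspace_ordge_vec k).2.
- move=> c p [a ka ->]; exists [ffun i => c * a i].
    by move=> i; rewrite ffunE; apply: ordgeMl.
  by rewrite /jac_comb mulr_sumr; apply: eq_bigr => i _; rewrite ffunE mulrA.
- move=> p [c [q [/ideal_exp_maxP kc /jacobianP [a ->] ->]]].
  exists [ffun i => c * a i]; first by move=> i; rewrite ffunE; apply: ordgeMr.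
  by rewrite /jac_comb mulr_sumr; apply: eq_bigr => i _; rewrite ffunE mulrA.
Qed.

Lemma tjurinaP k p : tjurina_ideal f k p <->
  exists g, milnor_ideal f k (p - g * mpseries_of f).
Proof.
split=> [[u [v [hu hv ->]]]|[g hg]].
  have [g ->] : exists g, u = g * mpseries_of f.
    move: u hu; apply: ideal_gen_closed.
    - split=> [|c p' q [a ->] [b ->]]; first by exists 0; rewrite mul0r.
      by exists (c *: a + b); rewrite mulrDl scalerAl.
    - by move=> c _ [a ->]; exists (c * a); rewrite mulrA.
    - by move=> _ ->; exists 1; rewrite mul1r.
  by exists g; rewrite addrAC subrr add0r.
exists (g * mpseries_of f), (p - g * mpseries_of f); split=> //; last by rewrite addrC subrK.
exists [:: (g, mpseries_of f)]; rewrite big_seq1; split=> // q.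
by rewrite inE => /eqP ->.
Qed.

Lemma subspace_milnor k : subspace (milnor_ideal f k).
Proof.
split=> [|c p q /milnorP [a ka ->] /milnorP [b kb ->]]; apply/milnorP.
  by exists 0; rewrite ?linear0 //; apply: subspace0 (subspace_ordge_vec k).
by exists (c *: a + b); rewrite ?linearP //; apply: (subspace_ordge_vec k).2.
Qed.

Lemma milnorM k a p : milnor_ideal f k p -> milnor_ideal f k (a * p).
Proof.
case/milnorP => b kb ->; apply/milnorP; exists [ffun i => a * b i].
  by move=> i; rewrite ffunE; apply: ordgeMl.
by rewrite /jac_comb mulr_sumr; apply: eq_bigr => i _; rewrite ffunE mulrA.
Qed.

Section Powers.
Context (N : nat) (w : 'I_n -> 'I_n -> O).
Hypothesis powE : forall i, Xpow K N i = \sum_j w i j * pder j.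

(** A monomial of degree at least n N is divisible by some x_i^N, which is in
    J. Dividing a monomial of degree at least k + n N by it leaves degree at
    least k. *)
Lemma ordge_milnor k p : (0 < n)%N -> ordge (k + n * N) p -> milnor_ideal f k p.
Proof.
move=> n0 kp; have mp : pow_ideal N n p.
  move=> m hm; apply: kp; apply: (@leq_trans (n * N)); last exact: leq_addl.
  rewrite mdegE -[X in (X * N)%N]card_ord -sum_nat_const.
  pose i := Ordinal n0; rewrite (bigD1 i) //= [ltnRHS](bigD1 i) //= -addSn leq_add ?hm //.
  by apply: leq_sum => j _; apply/ltnW/hm.
have [a [ka ->]] := pow_ideal_decomp mp kp.
apply: (subspace_sum (subspace_milnor k)) => i _; rewrite powE mulrC mulr_sumr.
apply/milnorP; exists [ffun j => a i * w i j].
  move=> j; rewrite ffunE; apply: ordgeMr; apply: ordge_leq (ka i).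
  by rewrite -addnBA ?leq_addr // leq_pmull.
by apply: eq_bigr => j _; rewrite ffunE mulrA.
Qed.

(** The exactness in degree 1 of the Koszul complex of the partial derivatives,
    with the powers x_i^N as the regular sequence. *)
Lemma syzygy (a : V1) : jac_comb a = 0 -> exists b, a = trivial_comb b.
Proof.
move=> a0.
(* the complex is indexed by nat, so families over 'I_n are extended by zero *)
pose ext (v : 'I_n -> O) (i : nat) : O := if insub i is Some j then v j else 0.
have extE v (i : 'I_n) : ext v i = v i by rewrite /ext valK.
pose phi (r : nat) : O -> O := if insub r is Some j then Xquo N j else fun=> 0.
have phiE (i : 'I_n) : phi i = Xquo N i by rewrite /phi valK.
have kf v : kdiff (ext pder) (kos1 n (ext v)) = kos0 n (\sum_i v i * pder i).
  by rewrite kdiff_kos1; congr kos0; apply: eq_bigr => i _; rewrite !extE.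
have [b b2 hb] : exists2 b : kos O n, kdeg 2 b &
    ksub (pow_ideal N 0) (kos1 n (ext a) - kdiff (ext pder) b).
  apply: (@koszul_exact_mod _ _ _ (pow_ideal N) (ext (Xpow K N)) phi
           (fun i => ext (fun j => ext (w^~ j) i))) => //.
  - move=> r c x y hx hy; apply: subspaceD (pow_idealM _ hx) hy; exact: subspace_pow_ideal.
  - move=> r; rewrite /phi; case: insubP => // i _ _; exact: Xquo0.
  - move=> r x rn; rewrite -[r]/(val (Ordinal rn)) extE phiE; exact: pow_ideal_quo.
  - move=> r x rn; rewrite -[r]/(val (Ordinal rn)) extE; exact: pow_ideal_reg.
  - by move=> r x rn hx m hm; apply: hx => i ir; apply: hm; exact: ltnW.
  - move=> r rn m hm; rewrite -[r]/(val (Ordinal rn)) extE /= mcoeffX.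
    case: eqP => // e; have := hm (Ordinal rn) (leqnn _).
    by rewrite -e mnm_pow eqxx ltnn.
  - move=> r rn; rewrite -[r]/(val (Ordinal rn)) extE powE.
    by apply: eq_bigr => j _; rewrite !extE.
  - exact: kdeg_kos1.
  - rewrite kf -/(jac_comb a) a0 kos0_0; apply: ksub0.
    by [].
have {}hb : kos1 n (ext a) = kdiff (ext pder) b.
  by apply/eqP; rewrite -subr_eq0; apply/eqP/(ksub_eq0 _ hb) => x hx; exact: (pow_ideal0 hx).
have [c cP] := kdiff_deg2 (ext pder) b2.
exists [ffun p : ltpair n => c (val p).1 (val p).2 : O]; apply/ffunP => j.
rewrite (trivial_comb_pairs (fun i j => c i j : O)).
have := kos1_inj (etrans hb cP) (ltn_ord j); rewrite extE => ->.
by congr (_ - _); apply: eq_bigr => i _; rewrite extE.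
Qed.

End Powers.
End Jacobian.

(** * Leading forms of syzygies and the modules Z_l *)

Section Graded.
Context (K : fieldType) (n : nat) (f : {mpoly K[n]}).
Local Notation O := {mpseries K[n]}.
Local Notation P := {mpoly K[n]}.
Local Notation V1 := {ffun 'I_n -> O}.
Local Notation V2 := {ffun ltpair n -> O}.
Local Notation E2 := {ffun ltpair n -> P}.
Local Notation E2mu := {ffun ltpair n -> {poly P}}.

(** The degree m_(i,j) of the generator v_(i,j). *)
Definition pair_mult (p : ltpair n) : nat := mij f (val p).1 (val p).2.

Lemma ordge_multiplicity (q : P) : ordge (multiplicity q) (mpseries_of q).
Proof.
move=> m mq /=; apply: memN_msupp_eq0; apply: contraTN mq => ms; rewrite -leqNgt /multiplicity.
elim: (msupp q) ms => [//|k s IH]; rewrite inE big_cons => /orP[/eqP ->|/IH h].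
  exact: geq_minl.
exact: leq_trans (geq_minr _ _) h.
Qed.

Lemma ordge_pder_l (p : ltpair n) : ordge (pair_mult p) (pder f (val p).1).
Proof. by apply: ordge_leq (@ordge_multiplicity _); exact: geq_minl. Qed.
Lemma ordge_pder_r (p : ltpair n) : ordge (pair_mult p) (pder f (val p).2).
Proof. by apply: ordge_leq (@ordge_multiplicity _); exact: geq_minr. Qed.

Lemma ordge_trivial_syz p j : ordge (pair_mult p) (trivial_syz f p j).
Proof.
rewrite trivial_syz.unlock; apply: ordgeB; case: eqP => _; rewrite ?mulr1n ?mulr0n;
  by [exact: ordge0 | exact: ordge_pder_l | exact: ordge_pder_r].
Qed.

(** The coefficient of mu^b in q(mu x) is the homogeneous part of degree b of
    q. *)
Lemma coef_dilate (q : P) b k : ((dilate q)`_b)@_k = if mdeg k == b then q@_k else 0.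
Proof.
have mm (m : 'X_{1..n}) :
    mmap1 (fun i : 'I_n => 'X * ('X_i : P)%:P) m = 'X^(mdeg m) * ('X_[m] : P)%:P.
  rewrite /mmap1 mdegE expr_sum mpolyXE_id rmorph_prod -big_split /=.
  by apply: eq_bigr => i _; rewrite exprMn rmorphXn.
rewrite /dilate /mmap coef_sum raddf_sum /=.
have -> : \sum_(m <- msupp q) ((((q@_m)%:MP)%:P * mmap1 (fun i : 'I_n => 'X * ('X_i : P)%:P) m)`_b)@_k
   = \sum_(m <- msupp q) (if mdeg m == b then q@_m * (m == k)%:R else 0).
  apply: eq_bigr => m _; rewrite mm mulrCA coefXnM -rmorphM coefC /=.
  case: ltnP => [bm|mb]; first by rewrite (gtn_eqF bm) mcoeff0.
  rewrite subn_eq0 eqn_leq mb; case: leqP => _ /=; last by rewrite mcoeff0.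
  by rewrite mcoeffCM mcoeffX.
rewrite -big_mkcond /=; have [kq|kq] := boolP (k \in msupp q).
  rewrite big_mkcond (bigD1_seq k) //= eqxx mulr1 big1 ?addr0 // => m /negbTE ->.
  by rewrite mulr0 if_same.
rewrite (memN_msupp_eq0 kq) if_same big_seq_cond big1 // => m /andP[mq _].
by case: eqP => [mk|_]; [rewrite -mk mq in kq | rewrite mulr0].
Qed.

Lemma coef_Tmu (p : ltpair n) (j : 'I_n) b k :
  ((Tmu f (val p).1 (val p).2 0 j)`_b)@_k =
    if mdeg k == (b + pair_mult p)%N then trivial_syz f p j k else 0.
Proof.
rewrite trivial_syz.unlock !mxE coef_drop_poly coefB mcoeffB !eqxx /=.
have e i (q : P) : ((dilate q * (j == i)%:R)`_(b + mij f (val p).1 (val p).2))@_k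
   = if mdeg k == (b + pair_mult p)%N then (mpseries_of q *+ (i == j)) k else 0.
  rewrite eq_sym; case: eqP => _; first by rewrite mulr1 coef_dilate mulr1n.
  by rewrite mulr0 coef0 mcoeff0 mulr0n if_same.
by rewrite !e; case: eqP => _; rewrite ?subr0.
Qed.

(** Here T is the series S(mu x)/mu^m. In the product with U, the power of mu
    that U must contribute to mu^s is determined by the degree of the monomial
    taken in S. *)
Lemma coef_mul_scaled (U T : {poly P}) (S : O) (m s : nat) (k : 'X_{1..n}) :
  ordge m S ->
  (forall b k, (T`_b)@_k = if mdeg k == (b + m)%N then S k else 0) ->
  ((U * T)`_s)@_k =
    \sum_(h : 'X_{1..n < (mdeg k).+1, (mdeg k).+1} | k == (h.1 + h.2)%MM)
      (if (mdeg h.2 <= s + m)%N then (U`_(s + m - mdeg h.2))@_h.1 else 0) * S h.2.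
Proof.
move=> mS TE; rewrite coefM raddf_sum /=.
under eq_bigr do rewrite mcoeffM.
rewrite exchange_big /=; apply: eq_bigr => -[h1 h2] /= _.
under eq_bigr do rewrite TE.
have [h2m|mh2] := ltnP (mdeg h2) m.
  by rewrite mS // mulr0 big1 // => i _; rewrite if_same mulr0.
have [h2s|sh2] := leqP (mdeg h2) (s + m); last first.
  rewrite mul0r big1 // => i _; rewrite gtn_eqF ?mulr0 //.
  by apply: leq_ltn_trans sh2; rewrite leq_add2r leq_subr.
have a0 : (s + m - mdeg h2 < s.+1)%N by rewrite ltnS leq_subLR addnC leq_add2r.
rewrite (bigD1 (Ordinal a0)) //= ifT; last by apply/eqP; lia.
rewrite big1 ?addr0 // => i ia; rewrite ifF ?mulr0 //; apply/negbTE.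
apply: contra ia => /eqP e; apply/eqP/val_inj => /=; have := ltn_ord i; lia.
Qed.

Definition hom_part (e : nat) (q : O) : P :=
  \sum_(m : 'X_{1..n < e.+1} | mdeg m == e) q m *: 'X_[m].

Lemma coef_hom_part e q k : (hom_part e q)@_k = if mdeg k == e then q k else 0.
Proof.
rewrite /hom_part raddf_sum /=; case: eqP => ke.
  have kb : (mdeg k < e.+1)%N by rewrite ke.
  rewrite (bigD1 (BMultinom kb)) /= ?ke // mcoeffZ mcoeffX eqxx mulr1 big1 ?addr0 //.
  move=> m /andP[_ mk]; rewrite mcoeffZ mcoeffX -[k]/(bmnm (BMultinom kb)) val_eqE.
  by rewrite (negbTE mk) mulr0.
rewrite big1 // => m /eqP me; rewrite mcoeffZ mcoeffX; case: eqP => [mk|]; rewrite ?mulr0 //.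
by case: ke; rewrite -mk.
Qed.

(** The elements of order at least d when v_(i,j) has degree m_(i,j). *)
Definition wfil (d : nat) (v : V2) := forall p, ordge (d - pair_mult p) (v p).

Definition lead_form (d : nat) (v : V2) : E2 :=
  [ffun p => if (pair_mult p <= d)%N then hom_part (d - pair_mult p) (v p) else 0].

Lemma coef_lead_form d v p k :
  (lead_form d v p)@_k = if (mdeg k + pair_mult p == d)%N then v p k else 0.
Proof.
rewrite ffunE; case: leqP => pd.
  by rewrite coef_hom_part -(eqn_add2r (pair_mult p)) subnK.
by rewrite mcoeff0 gtn_eqF // ltn_addl.
Qed.

Fact lead_form_is_linear d : linear (lead_form d).
Proof.
move=> c u v; apply/ffunP => p; apply/mpolyP => k.
have lin (W : lmodType K) (x y : {ffun ltpair n -> W}) : (c *: x + y) p = c *: x p + y p.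
  by rewrite ffunE [X in X + _]ffunE.
rewrite lin mcoeffD mcoeffZ !coef_lead_form lin ps_coefD.
by case: ifP => _; rewrite ?mulr0 ?addr0.
Qed.
HB.instance Definition _ d := GRing.isLinear.Build K V2 E2 *:%R (lead_form d) (lead_form_is_linear d).

Lemma wfilP d v : wfil d v <-> forall p k, (mdeg k + pair_mult p < d)%N -> v p k = 0.
Proof.
split=> h p k; first by move=> kd; apply: h; rewrite ltn_subRL addnC.
by rewrite ltn_subRL addnC; apply: h.
Qed.

Lemma subspace_wfil d : subspace (wfil d).
Proof.
split=> [p|c a b ha hb p]; first by rewrite ffunE; exact: ordge0.
by rewrite !ffunE; apply: (subspace_ordge _ _ _).2.
Qed.

Lemma E2_deg_lead_form d v : E2_deg f d (lead_form d v).
Proof.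
move=> p k; rewrite mcoeff_msupp coef_lead_form -/(pair_mult p) => h; apply/eqP.
by apply: contraNT h => /negbTE ->.
Qed.

Lemma lead_form_eq0 d v : wfil d v -> (wfil d.+1 v <-> lead_form d v = 0).
Proof.
move=> /wfilP hv; split=> [/wfilP hv1|h0].
  apply/ffunP => p; apply/mpolyP => k; rewrite coef_lead_form ffunE mcoeff0.
  by case: eqP => // e; apply: hv1; rewrite e.
apply/wfilP => p k; rewrite ltnS leq_eqVlt => /orP[e|]; last exact: hv.
by have := coef_lead_form d v p k; rewrite e h0 ffunE mcoeff0.
Qed.

Lemma Ztilde_coef l (u : E2mu) :
  Ztilde f l u <-> forall j s k, (s < l)%N -> ((Delta2 f u 0 j)`_s)@_k = 0.
Proof.
split=> [[w ->] j s k sl|h]; first by rewrite mxE coefXnM sl mcoeff0.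
exists (map_mx (drop_poly l) (Delta2 f u)); apply/rowP => j; rewrite !mxE.
apply/polyP => s; rewrite coefXnM; case: ltnP => sl.
  by apply/mpolyP => k; rewrite mcoeff0; apply: h.
by rewrite coef_drop_poly subnK.
Qed.

Lemma coef_Delta2 (u : E2mu) j s k : ((Delta2 f u 0 j)`_s)@_k =
  \sum_p \sum_(h : 'X_{1..n < (mdeg k).+1, (mdeg k).+1} | k == (h.1 + h.2)%MM)
      (if (mdeg h.2 <= s + pair_mult p)%N then ((u p)`_(s + pair_mult p - mdeg h.2))@_h.1 else 0)
      * trivial_syz f p j h.2.
Proof.
rewrite /Delta2 summxE coef_sum raddf_sum /=; apply: eq_bigr => p _; rewrite mxE.
apply: coef_mul_scaled; first exact: ordge_trivial_syz.
by move=> b h; exact: coef_Tmu.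
Qed.

Lemma coef_trivial_comb (v : V2) j k : trivial_comb f v j k =
  \sum_p \sum_(h : 'X_{1..n < (mdeg k).+1, (mdeg k).+1} | k == (h.1 + h.2)%MM)
      v p h.1 * trivial_syz f p j h.2.
Proof. by rewrite ffunE ps_coef_sum. Qed.

(** The lift of the leading form is the dilation of v divided by mu^d: the part
    of v of degree d + a, times mu^a. Only the parts with a <= l are kept, as a
    polynomial in mu is needed and higher ones do not matter modulo mu^l. *)
Lemma Z_lead_form d l v : wfil d v -> ordge_vec (d + l) (trivial_comb f v) -> Z f l (lead_form d v).
Proof.
move=> /wfilP dv dlv.
pose u : E2mu := [ffun p => \poly_(a < l.+1) lead_form (d + a) v p].
have uE p a k : ((u p)`_a)@_k = if (a <= l)%N && (mdeg k + pair_mult p == d + a)%N then v p k else 0.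
  rewrite ffunE coef_poly ltnS; case: leqP => _ /=; first by rewrite coef_lead_form.
  by rewrite mcoeff0.
exists u; last first.
  by apply/ffunP => p; apply/mpolyP => k; rewrite ffunE uE addn0 coef_lead_form.
apply/Ztilde_coef => j s k sl; rewrite coef_Delta2.
have [kds|kds] := eqVneq (mdeg k) (d + s)%N.
  rewrite -[RHS](dlv j k); last by rewrite kds ltn_add2l.
  rewrite coef_trivial_comb; apply: eq_bigr => p _; apply: eq_bigr => -[h1 h2] /= /eqP kh.
  have kd : mdeg k = (mdeg h1 + mdeg h2)%N by rewrite -mdegD -kh.
  have [h2p|ph2] := ltnP (mdeg h2) (pair_mult p); first by rewrite ordge_trivial_syz ?mulr0.
  congr (_ * _); case: ifP => h2s.
    rewrite uE; case: andP => // ab; exfalso; apply: ab; split; first lia.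
    by apply/eqP; lia.
  by rewrite dv //; lia.
rewrite big1 // => p _; rewrite big1 // => -[h1 h2] /= /eqP kh.
have kd : mdeg k = (mdeg h1 + mdeg h2)%N by rewrite -mdegD -kh.
case: ifP => h2s; rewrite ?mul0r // uE; case: andP => [[_ /eqP e]|_]; rewrite ?mul0r //.
by move/eqP: kds; lia.
Qed.

(** Set mu = 1 in a lift u of z, but keep only what is homogeneous of degree d
    for the grading in which mu has degree -1. Since [Delta2] preserves this
    degree, divisibility by mu^l becomes order at least d + l. *)
Lemma Z_lift d l z : Z f l z -> E2_deg f d z ->
  exists v, [/\ wfil d v, ordge_vec (d + l) (trivial_comb f v) & lead_form d v = z].
Proof.
move=> [u /Ztilde_coef uZ <-] dz.
pose v : V2 := [ffun p => MPSeries (fun k =>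
  if (d <= mdeg k + pair_mult p)%N then ((u p)`_(mdeg k + pair_mult p - d))@_k else 0)].
have vE p k : v p k =
    if (d <= mdeg k + pair_mult p)%N then ((u p)`_(mdeg k + pair_mult p - d))@_k else 0.
  by rewrite ffunE.
exists v; split.
- by apply/wfilP => p k kd; rewrite vE leqNgt kd.
- move=> j k kdl; rewrite coef_trivial_comb; have [kd|dk] := ltnP (mdeg k) d.
    rewrite big1 // => p _; rewrite big1 // => -[h1 h2] /= /eqP kh.
    have kD : mdeg k = (mdeg h1 + mdeg h2)%N by rewrite -mdegD -kh.
    have [h2p|ph2] := ltnP (mdeg h2) (pair_mult p); first by rewrite ordge_trivial_syz ?mulr0.
    by rewrite vE ifF ?mul0r //; apply/negbTE; rewrite -ltnNge; lia.
  rewrite -[RHS](uZ j (mdeg k - d)%N k); last lia.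
  rewrite coef_Delta2; apply: eq_bigr => p _; apply: eq_bigr => -[h1 h2] /= /eqP kh.
  have kD : mdeg k = (mdeg h1 + mdeg h2)%N by rewrite -mdegD -kh.
  have [h2p|ph2] := ltnP (mdeg h2) (pair_mult p); first by rewrite ordge_trivial_syz ?mulr0.
  congr (_ * _); rewrite vE.
  have -> : (mdeg h2 <= mdeg k - d + pair_mult p)%N = (d <= mdeg h1 + pair_mult p)%N by lia.
  case: ifP => // h; congr ((_`_ _)@__); lia.
- apply/ffunP => p; apply/mpolyP => k; rewrite coef_lead_form vE !ffunE.
  case: eqP => e; first by rewrite e leqnn subnn.
  apply/esym/memN_msupp_eq0/negP => hk; apply: e; apply: dz; by rewrite ffunE.
Qed.

Lemma subspace_Z l : subspace (Z f l).
Proof.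
split=> [|c _ _ [u [w uw] <-] [v [y vy] <-]].
  exists 0; last by apply/ffunP => p; rewrite !ffunE coef0.
  exists 0; rewrite scaler0 /Delta2 big1 // => p _.
  by rewrite ffunE scale0r.
exists [ffun p => (c%:MP)%:P * u p + v p]; last first.
  by apply/ffunP => p; rewrite !ffunE coefD coefCM mul_mpolyC.
exists ((c%:MP)%:P *: w + y).
rewrite scalerDr scalerA mulrC -scalerA -uw -vy /Delta2 scaler_sumr -big_split.
by apply: eq_bigr => p _; rewrite ffunE scalerDl scalerA.
Qed.

Lemma Z_decr l z : Z f l.+1 z -> Z f l z.
Proof.
case=> u [w uw] uz; exists u => //; exists ('X *: w).
by rewrite uw scalerA -exprSr.
Qed.

Lemma subspace_E2_deg d : subspace (E2_deg f d).
Proof.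
have E z : E2_deg f d z <-> forall p k, (mdeg k + pair_mult p != d)%N -> (z p)@_k = 0.
  split=> h p k.
    by move=> e; apply: memN_msupp_eq0; apply: contra e => /h ->.
  by rewrite mcoeff_msupp => zk; apply/eqP; apply: contraNT zk => /h ->.
split=> [|c z y /E hz /E hy]; apply/E => p k e; first by rewrite ffunE mcoeff0.
by rewrite !ffunE mcoeffD mcoeffZ hz // hy // mulr0 addr0.
Qed.

Lemma lead_form_E2_deg d z : E2_deg f d z -> lead_form d [ffun p => mpseries_of (z p)] = z.
Proof.
move=> dz; apply/ffunP => p; apply/mpolyP => k; rewrite coef_lead_form ffunE /=.
case: eqP => // e; apply/esym/memN_msupp_eq0/negP => hk; apply: e; exact: dz.
Qed.

End Graded.

(** * The higher Milnor numbers *)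

(** Exponents of degree at most k are the ordered partitions of integers up to
    k into n parts. *)
Lemma card_monomials n k : #|{: 'X_{1..n < k.+1}}| = 'C(n + k, n).
Proof.
rewrite -card_partial_ord_partitions -cardsT.
pose h (m : 'X_{1..n < k.+1}) : n.-tuple 'I_k.+1 := [tuple inord (bmnm m i) | i < n].
have mk (m : 'X_{1..n < k.+1}) i : (bmnm m i < k.+1)%N.
  by apply: leq_ltn_trans (bmdeg m); rewrite mdegE (bigD1 i) //= leq_addr.
have hE m i : tnth (h m) i = bmnm m i :> nat by rewrite tnth_mktuple inordK.
have hinj : injective h.
  by move=> m m' e; apply/val_inj/mnmP => i; rewrite /= -!hE e.
rewrite -(card_imset _ hinj); apply: eq_card => t; rewrite inE.
apply/imsetP/idP => [[m _ ->]|tk].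
  rewrite big_tuple; under eq_bigr do rewrite hE.
  by rewrite -mdegE -ltnS bmdeg.
have mt : (mdeg [multinom (tnth t i : nat) | i < n] < k.+1)%N.
  rewrite mdegE ltnS; apply: leq_trans tk; rewrite [leqRHS]big_tuple.
  by apply: leq_sum => i _; rewrite mnmE.
exists (BMultinom mt) => //; apply/eq_from_tnth => i; apply/val_inj.
by rewrite /= hE /= mnmE.
Qed.

Lemma card_monomials0 n : #|{: 'X_{1..n < 0}}| = 0%N.
Proof. by apply: eq_card0 => -[m hm]. Qed.

Section OrderDim.
Context (K : fieldType) (n : nat).
Local Notation O := {mpseries K[n]}.

Lemma is_dimq_ordge_family (I : finType) (e : I -> nat) :
  is_dimq (fun _ : {ffun I -> O} => True) (fun v => forall i, ordge (e i) (v i))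
    (\sum_i #|{: 'X_{1..n < e i}}|).
Proof.
pose T := {i : I & 'X_{1..n < e i}} : finType.
have -> : (\sum_i #|{: 'X_{1..n < e i}}| = #|T|)%N.
  by rewrite card_tagged sumnE big_map big_enum.
apply: (@is_dimq_coord K {ffun I -> O} _ _ T (fun t v => v (tag t) (bmnm (tagged t)))) => //.
- by move=> t a u v; rewrite !ffunE.
- move=> c; exists [ffun i => MPSeries (fun m =>
      if insub m : option 'X_{1..n < e i} is Some b then c (Tagged (fun i => 'X_{1..n < e i}) b) else 0)] => //.
  move=> [i b]; rewrite ffunE /= valK //.
- move=> v _; split=> [h [i b]|h i m me]; first by rewrite h // bmdeg.
  exact: (h (Tagged (fun i => 'X_{1..n < e i}) (BMultinom me))).
Qed.

Lemma is_dimq_ordge k : is_dimq (fun _ : O => True) (ordge k) #|{: 'X_{1..n < k}}|.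
Proof.
apply: (@is_dimq_coord K O _ _ 'X_{1..n < k} (fun t v => v (bmnm t))) => //.
- move=> c; exists (MPSeries (fun m =>
      if insub m : option 'X_{1..n < k} is Some b then c b else 0)) => //.
  by move=> b; rewrite /= valK.
- move=> v _; split=> [h b|h m me]; first by rewrite h // bmdeg.
  exact: (h (BMultinom me)).
Qed.

End OrderDim.

Section Formula.
Context (K : fieldType) (n : nat) (n0 : (0 < n)%N) (f : {mpoly K[n]}).
Local Notation O := {mpseries K[n]}.
Local Notation V1 := {ffun 'I_n -> O}.
Local Notation V2 := {ffun ltpair n -> O}.
Context (N : nat) (w : 'I_n -> 'I_n -> O).
Hypothesis powE : forall i, Xpow K N i = \sum_j w i j * pder f j.

Definition dimZ (l d : nat) : nat :=
  dimq (fun z => Z f l z /\ E2_deg f d z) (fun z => z = 0 /\ E2_deg f d z).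

Lemma findim_milnor k : findimq (fun=> True) (milnor_ideal f k).
Proof.
apply: (@findimq_quot _ _ _ _ (@ordge K n (k + n * N))) => //.
- exact: subspace_milnor.
- exact: subspace_ordge.
- move=> p; exact: (ordge_milnor powE n0).
- by eexists; exact: is_dimq_ordge.
Qed.

(** The preimage of m^k O^n under the map from the free module on the v_(i,j).
    *)
Definition comb_ordge (k : nat) (v : V2) := ordge_vec k (trivial_comb f v).

Lemma subspace_comb_ordge k : subspace (comb_ordge k).
Proof. exact: (subspace_preim (trivial_comb f) (subspace_ordge_vec K n k)). Qed.

Lemma wfil_comb_ordge k v : wfil f k v -> comb_ordge k v.
Proof.
move=> kv j; rewrite ffunE; apply: ordge_sum => p _.
apply: (@ordge_leq _ _ (k - pair_mult f p + pair_mult f p)); first by rewrite addnC -leq_subLR.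
by apply: ordgeM (kv p) _; exact: ordge_trivial_syz.
Qed.

Lemma findim_wfil k : findimq (fun=> True) (wfil f k).
Proof. by eexists; exact: is_dimq_ordge_family. Qed.

(** In the chain of the intersections with wfil d for d <= k, the step at d
    consists of leading forms of degree d, which form the component of degree d
    of Z_(k-d). *)
Lemma dim_comb_ordge_wfil k : dimq (comb_ordge k) (wfil f k) = (\sum_(d < k) dimZ (k - d) d)%N.
Proof.
pose A d v := comb_ordge k v /\ wfil f d v.
have sA d : subspace (A d) by apply: subspaceI; [exact: subspace_comb_ordge | exact: subspace_wfil].
have filS d v : wfil f d.+1 v -> wfil f d v.
  by move/wfilP => h; apply/wfilP => p m md; apply: h; exact: ltnW.
have AS d v : A d.+1 v -> A d v by case=> h1 /filS.
have A0 d v : A d v -> A 0 v by case=> h1 _; split=> // p.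
have filk d v : (d <= k)%N -> wfil f k v -> wfil f d v.
  by move=> dk /wfilP h; apply/wfilP => p m md; apply: h; exact: leq_trans md dk.
(* finiteness is what makes the dimensions of the chain add up *)
have finA d : (d <= k)%N -> findimq (A 0) (A d).
  move=> dk; apply: (@findimq_sub _ _ (fun=> True)) => //.
  apply: (findimq_quot _ _ (subspace_wfil f k)) (findim_wfil k) => // v kv.
  by split; [exact: wfil_comb_ordge | exact: filk kv].
have step d : (d < k)%N -> dimq (A d) (A d.+1) = dimZ (k - d) d.
  move=> dk; have fin : findimq (A d) (A d.+1).
    by apply: (@findimq_sub _ _ (A 0)) (finA _ dk) => // v; exact: A0.
  have [] := @dimq_linear _ _ _ (A d) (A d.+1)
    (fun z => Z f (k - d) z /\ E2_deg f d z) (fun z => z = 0 /\ E2_deg f d z) (lead_form f d) => //.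
  - by apply: subspaceI; [exact: subspace_eq0 | exact: subspace_E2_deg].
  - move=> v [dv fv]; split; last exact: E2_deg_lead_form.
    by apply: Z_lead_form => //; rewrite subnKC // ltnW.
  - move=> z [Zz dz]; have [v [fv dv <-]] := Z_lift Zz dz.
    rewrite (subnKC (ltnW dk)) in dv; exists v; first by split; [exact: dv | exact: fv].
    by rewrite subrr; split; [|exact: (subspace_E2_deg f d).1].
  - move=> v [dv fv]; split=> [[_ /(lead_form_eq0 fv) h]|[/(lead_form_eq0 fv) h _]].
      by split; [exact: h | exact: E2_deg_lead_form].
    by split; [exact: dv | exact: h].
have tele e : (e <= k)%N -> dimq (A 0) (A e) = (\sum_(d < e) dimZ (k - d) d)%N.
  elim: e => [|e IH] ek; first by rewrite big_ord0 dimq_refl.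
  rewrite (@dimq_add _ _ _ (A e)) //; [|exact: AS|exact: A0|exact: finA].
  by rewrite IH 1?ltnW // step // big_ord_recr.
rewrite -tele //; apply: dimq_iff => v; split=> [h|[]//]; split=> //; exact: wfil_comb_ordge.
Qed.

(** Compute J/m^k J as the quotient of O^n by m^k O^n and the syzygies (e2),
    and then the dimension of the syzygies modulo m^k O^n as a quotient of the
    free module on the v_(i,j) (e4); e1, e3 and e5 are the additivity of
    dimension. *)
Theorem milnor_formula k :
  (milnor f k + \sum_p #|{: 'X_{1..n < k - pair_mult f p}}| =
   milnor f 0 + n * #|{: 'X_{1..n < k}}| + \sum_(d < k) dimZ (k - d) d)%N.
Proof.
pose B (a : V1) := exists b c, ordge_vec k b /\ a = b + trivial_comb f c.
have sB : subspace B.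
  split=> [|x _ _ [b [c [hb ->]]] [b' [c' [hb' ->]]]].
    by exists 0, 0; rewrite linear0 addr0; split=> //; exact: (subspace_ordge_vec _ _ _).1.
  exists (x *: b + b'), (x *: c + c'); split; first exact: (subspace_ordge_vec _ _ _).2.
  by rewrite linearP scalerDr addrACA.
have kB b : ordge_vec k b -> B b by move=> hb; exists b, 0; rewrite linear0 addr0.
have sk := subspace_ordge_vec K n k.
have fink : findimq (fun _ : V1 => True) (ordge_vec k).
  by eexists; exact: (is_dimq_ordge_family _ _ (fun=> k)).
have e1 : milnor f k = (milnor f 0 + dimq (milnor_ideal f 0) (milnor_ideal f k))%N.
  apply: dimq_add => //; [exact: subspace_milnor | exact: subspace_milnor | | exact: findim_milnor].
  by move=> p /milnorP [a _ ->]; apply/milnorP; exists a.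
have finB : findimq (fun=> True) B by apply: (findimq_quot _ _ sk kB) fink.
have e2 : dimq (fun=> True) B = dimq (milnor_ideal f 0) (milnor_ideal f k).
  have [] // := @dimq_linear _ _ _ (fun=> True) B (milnor_ideal f 0) (milnor_ideal f k) (jac_comb f).
  - exact: subspace_milnor.
  - by move=> a _; apply/milnorP; exists a.
  - move=> p /milnorP [a _ ->]; exists a => //; rewrite subrr.
    by apply: subspace0; exact: subspace_milnor.
  - move=> a _; split=> [[b [c [hb ->]]]|/milnorP [b hb e]].
      by rewrite linearD /= jac_comb_trivial addr0; apply/milnorP; exists b.
    have [c cP] : exists c, a - b = trivial_comb f c.
      by apply: (syzygy powE); rewrite linearB /= e subrr.
    by exists b, c; rewrite -cP addrC subrK.
have e3 : (n * #|{: 'X_{1..n < k}}|)%N = (dimq (fun=> True) B + dimq B (ordge_vec k))%N.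
  rewrite -(dimq_add (A := fun=> True)) //.
  rewrite (dimqE _ (is_dimq_ordge_family _ _ (fun=> k))) //.
  by rewrite sum_nat_const card_ord.
have finD : findimq (fun=> True) (comb_ordge k).
  apply: (findimq_quot _ _ (subspace_wfil f k)) (findim_wfil k) => //.
    exact: subspace_comb_ordge.
  exact: wfil_comb_ordge.
have e4 : dimq (fun=> True) (comb_ordge k) = dimq B (ordge_vec k).
  have [] // := @dimq_linear _ _ _ (fun=> True) (comb_ordge k) B (ordge_vec k) (trivial_comb f).
  - exact: subspace_comb_ordge.
  - by move=> v _; exists 0, v; rewrite add0r; split=> //; exact: sk.1.
  - by move=> _ [b [c [hb ->]]]; exists c => //; rewrite addrK.
have e5 : (\sum_p #|{: 'X_{1..n < k - pair_mult f p}}|)%N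
    = (dimq (fun=> True) (comb_ordge k) + \sum_(d < k) dimZ (k - d) d)%N.
  rewrite -dim_comb_ordge_wfil -(dimq_add (A := fun=> True)) //.
  - by rewrite (dimqE _ (is_dimq_ordge_family _ _ (fun p => k - pair_mult f p)%N)) //; exact: subspace_wfil.
  - exact: subspace_comb_ordge.
  - exact: subspace_wfil.
  - exact: wfil_comb_ordge.
  - exact: findim_wfil.
lia.
Qed.

End Formula.

(** * The higher Tjurina numbers *)

Section Order.
Context (K : fieldType) (n : nat).
Local Notation O := {mpseries K[n]}.

Lemma exact_order (p : O) : p != 0 -> exists r, ordge r p /\ hom_part r p != 0.
Proof.
move=> p0; have [m pm] : exists m, p m != 0.
  apply: contrapT => h; move/eqP: p0; apply; apply: mpseriesP => m.
  by apply/eqP/negPn/negP => pm; apply: h; exists m.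
pose Q r := `[< exists m, mdeg m = r /\ p m != 0 >].
have exQ : exists r, Q r by exists (mdeg m); apply/asboolP; exists m.
have [r /asboolP [u [ur pu]] rmin] := ex_minnP exQ.
exists r; split=> [v vr|].
  apply/eqP/negPn/negP => pv; have : (r <= mdeg v)%N by apply: rmin; apply/asboolP; exists v.
  by rewrite leqNgt vr.
apply: contraNneq pu => /(congr1 (mcoeff u)).
by rewrite coef_hom_part ur eqxx mcoeff0 => ->.
Qed.

(** Orders add because the product of the leading forms, in the integral domain
    of polynomials, is not zero. *)
Lemma order_mul (p q : O) r s k : ordge r p -> hom_part r p != 0 ->
  ordge s q -> hom_part s q != 0 -> ordge k (p * q) -> (k <= r + s)%N.
Proof.
move=> rp p0 sq q0 kpq; rewrite leqNgt; apply/negP => rsk.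
have : hom_part r p * hom_part s q != 0 by rewrite mulf_eq0 negb_or p0 q0.
move/eqP; apply; apply/mpolyP => m; rewrite mcoeff0 mcoeffM.
have [mrs|mrs] := eqVneq (mdeg m) (r + s)%N.
  rewrite -[RHS](kpq m); last by rewrite mrs.
  rewrite ps_coefM; apply: eq_bigr => -[u v] /= /eqP muv; rewrite !coef_hom_part.
  have mD : mdeg m = (mdeg u + mdeg v)%N by rewrite -mdegD -muv.
  case: (ltngtP (mdeg u) r) => ur; last by rewrite (_ : mdeg v = s) ?eqxx //; lia.
    by rewrite rp ?mul0r.
  by rewrite [q v]sq ?mul0r ?mulr0 //; lia.
rewrite big1 // => -[u v] /= /eqP muv; rewrite !coef_hom_part.
have mD : mdeg m = (mdeg u + mdeg v)%N by rewrite -mdegD -muv.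
case: eqP => ur; last by rewrite mul0r.
case: eqP => vs; last by rewrite mulr0.
by rewrite mD ur vs eqxx in mrs.
Qed.

Definition mulby (g p : O) : O := p * g.
Fact mulby_is_linear g : linear (mulby g).
Proof. by move=> c a b; rewrite /mulby mulrDl scalerAl. Qed.
HB.instance Definition _ g := GRing.isLinear.Build K O O *:%R (mulby g) (mulby_is_linear g).
End Order.

Section Tjurina.
Context (K : fieldType) (n : nat) (f : {mpoly K[n]}).
Local Notation O := {mpseries K[n]}.
Hypothesis f0 : f != 0.
Hypothesis fmJ : milnor_ideal f 1 (mpseries_of f).
Hypothesis fin : forall k, findimq (fun=> True) (milnor_ideal f k).

Lemma mpseries_of_inj : injective (@mpseries_of K n).
Proof.
by move=> p q e; apply/mpolyP => m; have := congr1 (fun s : O => s m) e.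
Qed.

Lemma ordge_pder s i : ordge s (mpseries_of f) -> ordge s.-1 (pder f i).
Proof.
move=> sf m ms /=; rewrite mcoeff_deriv -[_@__]/((mpseries_of f) (m + U_(i))%MM).
by rewrite sf ?mul0rn // mdegD mdeg1 addn1; case: s ms {sf}.
Qed.

(** The colon ideal (m^k J : f) is m^(k-1). One inclusion is f in mJ. For the
    other, if f has order s then J has no element of order below s - 1, so g f
    in m^k J has order at least k + s - 1, and g has order at least k - 1. *)
Lemma colon_milnor k g : milnor_ideal f k (g * mpseries_of f) <-> ordge k.-1 g.
Proof.
split=> [|kg]; last first.
  case: k kg => [|k] kg.
    have /milnorP [a _ e] := fmJ.
    by apply: milnorM; apply/milnorP; exists a.
  have /milnorP [a a1 ->] := fmJ; apply/milnorP; exists [ffun i => g * a i].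
    by move=> i; rewrite ffunE -addn1; apply: ordgeM.
  by rewrite /jac_comb mulr_sumr; apply: eq_bigr => i _; rewrite ffunE mulrA.
case/milnorP => a ka e.
have [g0|g0] := eqVneq g 0; first by rewrite g0; exact: ordge0.
have F0 : mpseries_of f != 0 :> O.
  apply: contra_neq f0 => e0; apply: mpseries_of_inj.
  by rewrite e0 raddf0.
have [r [rg gr0]] := exact_order g0; have [s [sf fs0]] := exact_order F0.
apply: (@ordge_leq _ _ r) => //.
have := order_mul rg gr0 sf fs0 (k := (k + s.-1)%N).
suff : ordge (k + s.-1)%N (g * mpseries_of f) by move=> h /(_ h); lia.
rewrite e; apply: ordge_sum => i _; apply: ordgeM; first exact: ka.
exact: ordge_pder.
Qed.

Lemma subspace_tjurina k : subspace (tjurina_ideal f k).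
Proof.
split=> [|c p q /tjurinaP [g hg] /tjurinaP [h hh]]; apply/tjurinaP.
  by exists 0; rewrite mul0r subr0; exact: (subspace_milnor f k).1.
exists (c *: g + h); have := (subspace_milnor f k).2 c _ _ hg hh.
by congr (milnor_ideal f k _); rewrite mulrDl scalerBr -scalerAl opprD addrACA.
Qed.

Lemma findim_tjurina k : findimq (fun=> True) (tjurina_ideal f k).
Proof.
apply: (findimq_quot _ _ (subspace_milnor f k)) (fin k) => //.
  exact: subspace_tjurina.
by move=> p hp; apply/tjurinaP; exists 0; rewrite mul0r subr0.
Qed.

(** Multiplication by f induces an isomorphism of O/m^(k-1) with (f, m^k J)/m^k
    J. *)
Lemma milnor_tjurina k : milnor f k = (tjurina f k + #|{: 'X_{1..n < k.-1}}|)%N.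
Proof.
have MT p : milnor_ideal f k p -> tjurina_ideal f k p.
  by move=> hp; apply/tjurinaP; exists 0; rewrite mul0r subr0.
have -> : milnor f k = (tjurina f k + dimq (tjurina_ideal f k) (milnor_ideal f k))%N.
  by apply: dimq_add => //; try exact: subspace_tjurina; try exact: subspace_milnor; exact: fin.
congr (_ + _)%N; rewrite -(dimqE (subspace_ordge K n k.-1) (is_dimq_ordge K n k.-1)).
have [] // := @dimq_linear _ _ _ (fun=> True) (ordge k.-1) (tjurina_ideal f k)
  (milnor_ideal f k) (mulby (mpseries_of f)).
- exact: subspace_ordge.
- exact: subspace_milnor.
- by eexists; exact: is_dimq_ordge.
- move=> g _; apply/tjurinaP; exists g; rewrite subrr; exact: (subspace_milnor f k).1.
- by move=> p /tjurinaP [g hg]; exists g.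
- by move=> g _; apply: iff_sym; exact: colon_milnor.
Qed.

End Tjurina.

(** * The gap decomposition and generating series in one variable *)

Section Gaps.
Context (K : fieldType) (n : nat) (f : {mpoly K[n]}).
Local Notation O := {mpseries K[n]}.
Local Notation V2 := {ffun ltpair n -> O}.

Definition dimZinf (d : nat) : nat :=
  dimq (fun z => Zinf f z /\ E2_deg f d z) (fun z => z = 0 /\ E2_deg f d z).
Definition dimgap (l d : nat) : nat :=
  dimq (fun z => Z f l z /\ E2_deg f d z) (fun z => Z f l.+1 z /\ E2_deg f d z).

(** The component is the image of the leading form map, which factors through
    the quotient by wfil (d + 1). *)
Lemma findim_E2_deg d : findimq (E2_deg f d) (fun z => z = 0 /\ E2_deg f d z).
Proof.
have s0 : subspace (fun z => z = 0 /\ E2_deg f d z).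
  by apply: subspaceI; [exact: subspace_eq0 | exact: subspace_E2_deg].
have sB := subspace_preim (lead_form f d) s0.
have finB : findimq (fun _ : V2 => True) (fun v => lead_form f d v = 0 /\ E2_deg f d (lead_form f d v)).
  apply: (findimq_quot _ sB (subspace_wfil f d.+1)) (findim_wfil f d.+1) => // v hv.
  split; last exact: E2_deg_lead_form.
  apply/lead_form_eq0 => //; apply/wfilP => p m md; move/wfilP: hv; apply; exact: ltnW.
have [] // := @dimq_linear _ _ _ (fun _ : V2 => True) _ (E2_deg f d) _ (lead_form f d) _ sB s0 finB.
- by move=> v _; exact: E2_deg_lead_form.
- move=> z dz; exists [ffun p => mpseries_of (z p)] => //.
  have -> : z - lead_form f d [ffun p => mpseries_of (z p)] = 0 by rewrite lead_form_E2_deg // subrr.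
  exact: s0.1.
Qed.

Lemma dimZS l d : dimZ f l d = (dimgap l d + dimZ f l.+1 d)%N.
Proof.
have s0 : subspace (fun z => z = 0 /\ E2_deg f d z).
  by apply: subspaceI; [exact: subspace_eq0 | exact: subspace_E2_deg].
have sZ j : subspace (fun z => Z f j z /\ E2_deg f d z).
  by apply: subspaceI; [exact: subspace_Z | exact: subspace_E2_deg].
have Z0 j z : z = 0 /\ E2_deg f d z -> Z f j z /\ E2_deg f d z.
  by case=> -> dz; split=> //; exact: (subspace_Z f j).1.
apply: dimq_add => //.
- exact: Z0.
- by move=> z [/Z_decr hz dz].
- by apply: (@findimq_sub _ _ (E2_deg f d)) (findim_E2_deg d) => // z [].
Qed.

Lemma dimgap0 l d : (1 <= l)%N -> ~ gap_number f l -> dimgap l d = 0%N.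
Proof.
move=> l1 ng; have ZZ z : Z f l z <-> Z f l.+1 z.
  by apply: contrapT => h; apply: ng; split=> // hz; apply: h.
rewrite /dimgap (@dimq_iff _ _ _ (fun z => Z f l z /\ E2_deg f d z) _
  (fun z => Z f l z /\ E2_deg f d z)) //.
  by rewrite dimq_refl //; apply: subspaceI; [exact: subspace_Z | exact: subspace_E2_deg].
by move=> z; rewrite ZZ.
Qed.

Lemma Z_decr_leq l l' z : (l <= l')%N -> Z f l' z -> Z f l z.
Proof.
move/subnKC <-; elim: (l' - l)%N => [|j IH]; first by rewrite addn0.
by rewrite addnS => /Z_decr.
Qed.

Context (L : seq nat) (uL : uniq L).
Hypothesis hgap : forall l, l \in L <-> gap_number f l.

(** The successive quotients vanish outside L, and beyond the last gap all the
    Z_j are equal to their intersection. *)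
Lemma dimZ_gaps l d : (1 <= l)%N ->
  dimZ f l d = (dimZinf d + \sum_(j <- L | (l <= j)%N) dimgap j d)%N.
Proof.
move=> l1; have [B lB LB] : exists2 B, (l <= B)%N & forall j, j \in L -> (j < B)%N.
  exists (l + \max_(j <- L) j.+1)%N; first exact: leq_addr.
  by move=> j jL; apply: leq_trans (leq_addl _ _); rewrite -[j.+1]/(S j) (big_rem j) //= leq_maxl.
have ZB : dimZ f B d = dimZinf d.
  apply: dimq_iff => // z; split=> [[hz dz]|[hz dz]]; split=> //; last exact: (hz B (leq_trans l1 lB)).
  move=> j _; have [jB|/ltnW Bj] := leqP j B; first exact: Z_decr_leq hz.
  rewrite -(subnKC Bj); elim: (j - B)%N => [|i IH]; first by rewrite addn0.
  have B1 : (1 <= B + i)%N by apply: leq_trans (leq_addr _ _); apply: leq_trans lB.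
  rewrite addnS; apply: contrapT => h.
  have : B + i \in L by apply/hgap; split=> // hh; apply: h; apply/hh.
  by move/LB; rewrite ltnNge leq_addr.
have tele : dimZ f l d = (dimZ f B d + \sum_(l <= j < B) dimgap j d)%N.
  rewrite -(subnKC lB); elim: (B - l)%N => [|i IH]; first by rewrite addn0 big_geq ?addn0.
  by rewrite IH addnS big_nat_recr ?leq_addr //= dimZS; lia.
rewrite tele ZB; congr (_ + _)%N.
rewrite -[RHS]big_filter (bigID (mem L)) /= [X in (_ + X)%N]big_nat_cond.
rewrite [X in (_ + X)%N]big1 ?addn0 => [|j /andP[/andP[lj _] jL]]; last first.
  by apply: dimgap0; [exact: leq_trans lj | move/hgap => h; rewrite h in jL].
rewrite -big_filter; apply: perm_big; apply: uniq_perm.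
- by rewrite filter_uniq // iota_uniq.
- by rewrite filter_uniq.
move=> j; rewrite !mem_filter mem_index_iota andbC [RHS]andbC /=.
by case jL: (j \in L); rewrite ?andbF ?andbT // (LB _ jL) andbT.
Qed.

End Gaps.

Section GenSeries.
Local Notation T := {mpseries rat[1]}.

Definition tmon (k : nat) : 'X_{1..1} := (U_(ord0) *+ k)%MM.

Lemma tmonE k : tmon k ord0 = k.
Proof. by rewrite /tmon mulmnE mnm1E eqxx mul1n. Qed.

Lemma tmonP (m : 'X_{1..1}) : m = tmon (m ord0).
Proof. by apply/mnmP => i; rewrite (ord1 i) tmonE. Qed.

Lemma eq_series (p q : T) : (forall k, p (tmon k) = q (tmon k)) -> p = q.
Proof. by move=> h; apply: mpseriesP => m; rewrite (tmonP m). Qed.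

Lemma coef_genseries a k : genseries a (tmon k) = (a k)%:R.
Proof. by rewrite /= tmonE. Qed.

Lemma coef_tvarXM j (p : T) k :
  (tvar ^+ j * p) (tmon k) = if (j <= k)%N then p (tmon (k - j)) else 0.
Proof.
have -> : tvar ^+ j = mpseries_of 'X_[tmon j] :> T.
  by rewrite /tvar -rmorphXn /= /tmon mpolyXn.
rewrite ps_coefXM pow_lem tmonE; case: leqP => // jk.
by congr (pscoef p _); rewrite [LHS]tmonP mnmBE !tmonE.
Qed.

Lemma coef_tvarM (p : T) k : (tvar * p) (tmon k) = if k is k'.+1 then p (tmon k') else 0.
Proof. by rewrite -[tvar]expr1 coef_tvarXM; case: k => [|k] //=; rewrite subn1. Qed.

Lemma onesubt_unit : (1 - tvar : T) \is a GRing.unit.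
Proof.
apply/unitrP; exists (MPSeries (fun=> 1)).
suff h : (1 - tvar) * MPSeries (fun=> 1) = 1 :> T by rewrite mulrC h.
apply: eq_series => k; rewrite mulrBl mul1r ps_coefB coef_tvarM ps_coef1 /=.
case: k => [|k]; first by rewrite subr0 (_ : tmon 0 = 0%MM) ?eqxx // /tmon mulm0n.
by rewrite subrr; case: eqP => // /(congr1 (fun m : 'X_{1..1} => m ord0)); rewrite tmonE mnm0E.
Qed.

Lemma coef_div_onesubt (p : T) k : (p / (1 - tvar)) (tmon k) = \sum_(j < k.+1) p (tmon j).
Proof.
pose s : T := MPSeries (fun m => \sum_(j < (m ord0).+1) p (tmon j)).
have sE i : s (tmon i) = \sum_(j < i.+1) p (tmon j) by rewrite /= tmonE.
rewrite -sE; congr (pscoef _ _); apply: (mulIr onesubt_unit); rewrite divrK ?onesubt_unit //.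
apply: eq_series => i; rewrite mulrC mulrBl mul1r ps_coefB coef_tvarM.
case: i => [|i]; rewrite !sE; first by rewrite subr0 big_ord1.
by rewrite [in RHS]big_ord_recr /= addrAC subrr add0r.
Qed.

(** By Pascal's rule, multiplication by 1 - t lowers n by one in the series of
    the binomials C(n + k, n). *)
Lemma inv_onesubt_pow n :
  tvar / (1 - tvar) ^+ n.+1 = genseries (fun k => #|{: 'X_{1..n < k}}|) :> T.
Proof.
have h m : (1 - tvar) ^+ m.+1 * genseries (fun k => 'C(m + k, m)) = 1 :> T.
  elim: m => [|m IH].
    rewrite expr1; apply: eq_series => k; rewrite mulrBl mul1r ps_coefB coef_tvarM ps_coef1.
    case: k => [|k]; rewrite !coef_genseries !bin0.
      by rewrite subr0 (_ : tmon 0 = 0%MM) ?eqxx // /tmon mulm0n.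
    by rewrite subrr; case: eqP => // /(congr1 (fun m : 'X_{1..1} => m ord0));
      rewrite tmonE mnm0E.
  rewrite exprSr -mulrA -[RHS]IH; congr (_ * _); apply: eq_series => k.
  rewrite mulrBl mul1r ps_coefB coef_tvarM coef_genseries.
  case: k => [|k]; first by rewrite subr0 coef_genseries !addn0 !binn.
  by rewrite !coef_genseries (addnS m.+1) binS natrD addrAC subrr add0r addSnnS.
have hu : ((1 - tvar) ^+ n.+1 : T) \is a GRing.unit by rewrite unitrX // onesubt_unit.
apply: (mulIr hu); rewrite divrK // mulrC.
have -> : genseries (fun k => #|{: 'X_{1..n < k}}|) = tvar * genseries (fun k => 'C(n + k, n)).
  apply: eq_series => k; rewrite coef_tvarM coef_genseries.
  by case: k => [|k]; rewrite ?card_monomials0 // card_monomials coef_genseries.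
by rewrite mulrCA h mulr1.
Qed.

End GenSeries.

(** * The generating series of the Milnor and Tjurina numbers *)

(** The gradient has no zero off the hyperplane x_i = 0, so the Nullstellensatz
    puts a power of x_i in J; the sum of the exponents serves for all
    variables. *)
Lemma jacobian_powers (K : numClosedFieldType) (n : nat) (f : {mpoly K[n]}) :
  uncountable_type K ->
  (forall x : 'I_n -> K, (forall i, (f^`M(i)).@[x] = 0) -> forall i, x i = 0) ->
  exists (N : nat) (w : 'I_n -> 'I_n -> {mpseries K[n]}),
    forall i, Xpow K N i = \sum_j w i j * pder f j.
Proof.
move=> uncK zero.
pose I (p : {mpoly K[n]}) := exists a : 'I_n -> {mpoly K[n]}, p = \sum_j a j * f^`M(j).
have iI : poly_ideal I.
  split=> [|c p q [a ->] [b ->]]; first by exists (fun=> 0); rewrite big1 // => j _; rewrite mul0r.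
  exists (fun j => c * a j + b j); rewrite mulr_sumr -big_split; apply: eq_bigr => j _.
  by rewrite mulrDl mulrA.
have Ider i : I f^`M(i).
  exists (fun j => (j == i)%:R); rewrite (bigD1 i) //= eqxx mul1r big1 ?addr0 // => j /negbTE ->.
  by rewrite mul0r.
have /choice [M MP] i : exists N, I ('X_i ^+ N).
  apply: contrapT => nN.
  have [N hN|a [Ia]] := @nullstellensatz K uncK n I 'X_i iI.
    by apply: nN; exists N.
  by rewrite mevalXU zero ?eqxx // => j; exact: Ia.
exists (\sum_i M i)%N.
have /choice [w wP] i : exists a : 'I_n -> {mpoly K[n]},
    'X_i ^+ (\sum_i M i) = \sum_j a j * f^`M(j) :> {mpoly K[n]}.
  by rewrite (bigD1 i) //= exprD mulrC; exact: (poly_idealM _ iI (MP i)).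
exists (fun i j => mpseries_of (w i j)) => i.
rewrite /Xpow -mpolyXn wP raddf_sum; apply: eq_bigr => j _.
by rewrite /= rmorphM.
Qed.

Lemma euler_milnor (K : numFieldType) (n : nat) (f : {mpoly K[n]}) (u : 'I_n -> nat) (V : nat) :
  (forall m, m \in msupp f -> (\sum_j m j * u j = V)%N) -> (0 < V)%N ->
  milnor_ideal f 1 (mpseries_of f).
Proof.
move=> fV V0; apply/milnorP.
exists [ffun i => mpseries_of ((V%:R^-1 * (u i)%:R) *: 'X_i)].
  move=> i m; rewrite ltnS leqn0 mdeg_eq0 => /eqP ->.
  by rewrite ffunE /= mcoeffZ mcoeffX -mdeg_eq0 mdeg1 mulr0.
have fE : f = \sum_i ((V%:R^-1 * (u i)%:R) *: 'X_i) * f^`M(i).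
  have VV : (V%:R : K) != 0 by rewrite pnatr_eq0 -lt0n.
  rewrite -[LHS](scalerK VV) -(euler_identity fV) scaler_sumr; apply: eq_bigr => i _.
  by rewrite scalerA -scalerAl.
rewrite /jac_comb; under eq_bigr do rewrite ffunE.
transitivity (mpseries_of (\sum_i ((V%:R^-1 * (u i)%:R) *: 'X_i) * f^`M(i))).
  by rewrite -fE.
by rewrite raddf_sum; apply: eq_bigr => i _; rewrite /= rmorphM.
Qed.

Section Coefficients.
Local Notation T := {mpseries rat[1]}.

Lemma ps_coefMn (p : T) k m : (p *+ k) m = p m *+ k.
Proof. by elim: k => [//|k IH]; rewrite !mulrS ps_coefD IH. Qed.

Lemma coef_shifted_monomials n j k :
  (tvar ^+ j * genseries (fun k => #|{: 'X_{1..n < k}}|)) (tmon k)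
  = (#|{: 'X_{1..n < k - j}}|)%:R.
Proof.
rewrite coef_tvarXM coef_genseries; case: leqP => // kj.
by rewrite (eqP (ltnW kj : (k - j == 0)%N)) card_monomials0.
Qed.

Lemma coef_euler_part n (m : 'I_n -> 'I_n -> nat) k :
  (tvar / (1 - tvar) ^+ n.+1 *
     (n%:R - \sum_(i < n) \sum_(j < n | (i < j)%N) tvar ^+ m i j) : T) (tmon k)
  = (n * #|{: 'X_{1..n < k}}|)%:R
    - (\sum_(p : ltpair n) #|{: 'X_{1..n < k - m (val p).1 (val p).2}}|)%:R.
Proof.
rewrite inv_onesubt_pow mulrBr ps_coefB mulr_natr ps_coefMn coef_genseries.
rewrite -mulrnA mulnC; congr (_ - _).
rewrite (sum_ltpair (fun i j => #|{: 'X_{1..n < k - m i j}}|)) natr_sum mulr_sumr ps_coef_sum.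
apply: eq_bigr => i _; rewrite natr_sum mulr_sumr ps_coef_sum; apply: eq_bigr => j _.
by rewrite mulrC coef_shifted_monomials.
Qed.

Lemma coef_const k : (k%:R : T) (tmon 0) = k%:R.
Proof. by rewrite ps_coefMn ps_coef1 (_ : tmon 0 = 0%MM) ?eqxx // /tmon mulm0n. Qed.
Lemma coef_constS k j : (k%:R : T) (tmon j.+1) = 0.
Proof.
rewrite ps_coefMn ps_coef1; case: eqP => [|_]; last exact: mul0rn.
by move/(congr1 (fun m : 'X_{1..1} => m ord0)); rewrite tmonE mnm0E.
Qed.

Lemma coef_limit_part c a k :
  ((c%:R + genseries a * tvar) / (1 - tvar) : T) (tmon k)
  = (c + \sum_(d < k) a d)%:R.
Proof.
rewrite coef_div_onesubt big_ord_recl natrD; congr (_ + _).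
  by rewrite ps_coefD coef_const mulrC coef_tvarM addr0.
have E (d : nat) : (c%:R + genseries a * tvar : T) (tmon d.+1) = (a d)%:R.
  by rewrite ps_coefD coef_constS add0r mulrC coef_tvarM coef_genseries.
by rewrite natr_sum; apply: eq_bigr => d _; exact: E.
Qed.

(** Dividing by 1 - t sums the coefficients. The sums up to k of the shifts of
    a by 1 and by l + 1 differ by the last l terms. *)
Lemma coef_gap_part l a k :
  ((tvar - tvar ^+ l.+1) / (1 - tvar) * genseries a : T) (tmon k)
  = (\sum_(d < k | (k - d <= l)%N) a d)%:R.
Proof.
rewrite mulrAC coef_div_onesubt big_ord_recl mulrBl.
have -> : (tvar * genseries a - tvar ^+ l.+1 * genseries a) (tmon (ord0 : 'I_k.+1)) = 0 :> rat.
  by rewrite ps_coefB coef_tvarM coef_tvarXM ltn0 subr0.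
have E (d : nat) : (tvar * genseries a - tvar ^+ l.+1 * genseries a) (tmon d.+1)
    = (a d)%:R - (if (l <= d)%N then (a (d - l)%N)%:R else 0) :> rat.
  by rewrite ps_coefB coef_tvarM coef_tvarXM !coef_genseries ltnS subSS.
rewrite add0r; under eq_bigr do rewrite E.
rewrite sumrB -natr_sum.
have -> : \sum_(i < k) (if (l <= i)%N then (a (i - l)%N)%:R else 0)
    = (\sum_(d < k | ~~ (k - d <= l)%N) a d)%:R :> rat.
  rewrite -big_mkcond -natr_sum; congr _%:R.
  rewrite -(big_mkord (fun i => l <= i)%N (fun i => a (i - l)%N)).
  rewrite -(big_mkord (fun d => ~~ (k - d <= l))%N a).
  have [kl|lk] := leqP k l.
    by rewrite [LHS]big_nat_cond [RHS]big_nat_cond !big_pred0 // => i; apply/negbTE; lia.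
  rewrite (big_cat_nat (n := l)) ?(ltnW lk) //= big_nat_cond big_pred0 ?add0n; last first.
    by move=> i; apply/negbTE; lia.
  rewrite [RHS](big_cat_nat (n := (k - l)%N)) ?leq_subr //=.
  rewrite [X in (_ = _ + X)%N]big_nat_cond [X in (_ = _ + X)%N]big_pred0 ?addn0; last first.
    by move=> i; apply/negbTE; lia.
  rewrite -{1}[l]add0n big_addn [LHS]big_nat_cond [RHS]big_nat_cond.
  apply: eq_big => [i|i _]; last by rewrite addnK.
  apply/idP/idP; lia.
by rewrite [X in X%:R - _](bigID (fun d : 'I_k => (k - d <= l)%N)) /= natrD addrK.
Qed.

End Coefficients.

Theorem higher_milnor_tjurina_series (K : numClosedFieldType) (uncK : uncountable_type K)
    (n : nat) (hn : (0 < n)%N) (f : {mpoly K[n]})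
    (hwh : weighted_homogeneous f) (hsing : isolated_singularity f)
    (L : seq nat) (hL : sorted ltn L)
    (hgap : forall l : nat, l \in L <-> gap_number f l) :
  (forall k : nat, findimq (fun=> True) (milnor_ideal f k)) /\
  (forall k : nat, findimq (fun=> True) (tjurina_ideal f k)) /\
  genseries (milnor f) =
    tvar / (1 - tvar) ^+ n.+1 *
      (n%:R - \sum_(i < n) \sum_(j < n | (i < j)%N) tvar ^+ mij f i j)
    + ((milnor f 0)%:R + hilbert_Zinf f * tvar) / (1 - tvar)
    + \sum_(l <- L) (tvar - tvar ^+ l.+1) / (1 - tvar) * hilbert_gap f l /\
  genseries (tjurina f) =
    tvar / (1 - tvar) ^+ n.+1 *
      (n%:R - tvar - \sum_(i < n) \sum_(j < n | (i < j)%N) tvar ^+ mij f i j)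
    + ((milnor f 0)%:R + hilbert_Zinf f * tvar) / (1 - tvar)
    + \sum_(l <- L) (tvar - tvar ^+ l.+1) / (1 - tvar) * hilbert_gap f l.
Proof.
have [u [V [u0 fV]]] := weighted_homogeneous_nat hwh.
have [V0 zero] := isolated_zero fV hn u0 hsing.
have f0 : f != 0.
  apply/eqP => fe; have d0 i : (f^`M(i)).@[fun=> 1] = 0 by rewrite fe !raddf0.
  by have /eqP := zero _ d0 (Ordinal hn); rewrite oner_eq0.
have [N [w powE]] := @jacobian_powers K n f uncK zero.
have fin := findim_milnor hn powE.
have fmJ := euler_milnor fV V0.
have fint := findim_tjurina fin.
split; [exact: fin|split; [exact: fint|]].
have uL : uniq L by exact: (sorted_uniq ltn_trans ltnn hL).
have milnorE : genseries (milnor f) =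
    tvar / (1 - tvar) ^+ n.+1 *
      (n%:R - \sum_(i < n) \sum_(j < n | (i < j)%N) tvar ^+ mij f i j)
    + ((milnor f 0)%:R + hilbert_Zinf f * tvar) / (1 - tvar)
    + \sum_(l <- L) (tvar - tvar ^+ l.+1) / (1 - tvar) * hilbert_gap f l.
  have -> : hilbert_Zinf f = genseries (dimZinf f) by [].
  apply: eq_series => k; rewrite coef_genseries 2!ps_coefD coef_euler_part coef_limit_part ps_coef_sum.
  have -> : \sum_(l <- L) ((tvar - tvar ^+ l.+1) / (1 - tvar) * hilbert_gap f l) (tmon k)
      = (\sum_(l <- L) \sum_(d < k | (k - d <= l)%N) dimgap f l d)%:R.
    by rewrite natr_sum; apply: eq_bigr => l _; exact: coef_gap_part.
  have := milnor_formula hn powE k.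
  have -> : (\sum_(d < k) dimZ f (k - d) d
     = \sum_(d < k) dimZinf f d + \sum_(l <- L) \sum_(d < k | (k - d <= l)%N) dimgap f l d)%N.
    transitivity (\sum_(d < k) (dimZinf f d + \sum_(l <- L | (k - d <= l)%N) dimgap f l d))%N.
      by apply: eq_bigr => d _; apply: (dimZ_gaps uL hgap); rewrite subn_gt0.
    by rewrite big_split /= (exchange_big_dep xpredT).
  move/(congr1 (fun x : nat => x%:R : rat)); rewrite !natrD => fE.
  by rewrite -[LHS](addrK (\sum_p #|{: 'X_{1..n < k - pair_mult f p}}|)%:R) fE; ring.
split=> //.
have -> : genseries (tjurina f) = genseries (milnor f) - tvar / (1 - tvar) ^+ n.+1 * tvar.
  apply: eq_series => k; rewrite ps_coefB !coef_genseries inv_onesubt_pow mulrC.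
  by rewrite -[tvar]expr1 coef_shifted_monomials (milnor_tjurina f0 fmJ fin) subn1 natrD addrK.
rewrite milnorE; ring.
Qed.

Theorem theorem3 (R : realType) (n : nat) (hn : (0 < n)%N)
    (f : {mpoly R[i][n]})
    (hwh : weighted_homogeneous f) (hsing : isolated_singularity f)
    (L : seq nat) (hL : sorted ltn L)
    (hgap : forall l : nat, l \in L <-> gap_number f l) :
  (forall k : nat, findimq (fun=> True) (milnor_ideal f k)) /\
  (forall k : nat, findimq (fun=> True) (tjurina_ideal f k)) /\
  genseries (milnor f) =
    tvar / (1 - tvar) ^+ n.+1 *
      (n%:R - \sum_(i < n) \sum_(j < n | (i < j)%N) tvar ^+ mij f i j)
    + ((milnor f 0)%:R + hilbert_Zinf f * tvar) / (1 - tvar)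
    + \sum_(l <- L) (tvar - tvar ^+ l.+1) / (1 - tvar) * hilbert_gap f l /\
  genseries (tjurina f) =
    tvar / (1 - tvar) ^+ n.+1 *
      (n%:R - tvar - \sum_(i < n) \sum_(j < n | (i < j)%N) tvar ^+ mij f i j)
    + ((milnor f 0)%:R + hilbert_Zinf f * tvar) / (1 - tvar)
    + \sum_(l <- L) (tvar - tvar ^+ l.+1) / (1 - tvar) * hilbert_gap f l.
Proof. exact: (higher_milnor_tjurina_series (@uncountable_complex R)). Qed.
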